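(* Let $n\in\mathbb{N}$, $n\ge2$, and let $\Omega\subset\mathbb{R}^n$ be an open, bounded, nonempty Lipschitz domain. Let $a_\Theta$ be a closed, symmetric sesquilinear form in $L^2(\partial\Omega;d^{n-1}\omega)$ with domain $H^{1/2}(\partial\Omega)\times H^{1/2}(\partial\Omega)$, bounded from below by $c_\Theta\in\mathbb{R}$, let $\widetilde\Theta\in\mathcal{B}(H^{1/2}(\partial\Omega),H^{-1/2}(\partial\Omega))$ be the associated operator, $\langle f,\widetilde\Theta g\rangle_{1/2}=a_\Theta(f,g)$ for $f,g\in H^{1/2}(\partial\Omega)$, and suppose that $\widetilde\Theta\in\mathcal{B}_\infty(H^1(\partial\Omega),L^2(\partial\Omega;d^{n-1}\omega))$. Suppose that $z\in\mathbb{C}\setminus(\sigma(-\Delta_{\Theta,\Omega})\cup\sigma(-\Delta_{D,\Omega}))$. Then the following Krein formula holds on $L^2(\Omega;d^nx)$: $$(-\Delta_{\Theta,\Omega}-zI_\Omega)^{-1}=(-\Delta_{D,\Omega}-zI_\Omega)^{-1}+\big[\widetilde\gamma_N(-\Delta_{D,\Omega}-\overline zI_\Omega)^{-1}\big]^*M^{(0)}_{\Theta,D,\Omega}(z)\big[\widetilde\gamma_N(-\Delta_{D,\Omega}-zI_\Omega)^{-1}\big].$$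
   Context: Lipschitz domain: $\partial\Omega$ is covered by finitely many open sets in each of which, after a rigid motion, $\Omega$ coincides with the region above the graph of a Lipschitz function on $\mathbb{R}^{n-1}$; $d^{n-1}\omega$ is the surface measure. $\mathcal{B}$ and $\mathcal{B}_\infty$ denote bounded and compact linear operators; $I_\Omega$ is the identity on $L^2(\Omega;d^nx)$. $H^s(\Omega)=\{U|_\Omega\,|\,U\in H^s(\mathbb{R}^n)\}$. For $0\le s\le1$, $H^s(\partial\Omega)$ is defined from $H^s(\mathbb{R}^{n-1})$ via partition of unity and local graph coordinates, and $H^{-s}(\partial\Omega)=(H^s(\partial\Omega))^*$, where $X^*$ denotes the space of continuous conjugate-linear functionals on $X$; $\langle\cdot,\cdot\rangle_{1/2}$ is the pairing of $H^{1/2}(\partial\Omega)$ with $H^{-1/2}(\partial\Omega)$ (antilinear in the first, linear in the second factor), equal to $\int_{\partial\Omega}d^{n-1}\omega\,\overline fg$ when $g\in L^2(\partial\Omega;d^{n-1}\omega)$. Boundedness from below of $a_\Theta$ by $c_\Theta$ means $a_\Theta(f,f)\ge c_\Theta\|f\|_{L^2}^2$; closedness means that $H^{1/2}(\partial\Omega)$ is complete under the norm $(a_\Theta(f,f)+(1-c_\Theta)\|f\|^2_{L^2})^{1/2}$. The condition $\widetilde\Theta\in\mathcal{B}_\infty(H^1(\partial\Omega),L^2(\partial\Omega;d^{n-1}\omega))$ means that $\widetilde\Theta$ restricted to $H^1(\partial\Omega)$ maps compactly into $L^2(\partial\Omega;d^{n-1}\omega)$. $\gamma_D\colon H^s(\Omega)\to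 H^{s-(1/2)}(\partial\Omega)$, $1/2<s<3/2$, is the Dirichlet trace; it also maps $\{u\in H^{3/2}(\Omega)\,|\,\Delta u\in L^2(\Omega;d^nx)\}$ (graph norm) boundedly into $H^1(\partial\Omega)$. The weak Neumann trace of $u\in H^1(\Omega)$ with $\Delta u\in L^2(\Omega;d^nx)$ is $\widetilde\gamma_Nu\in H^{-1/2}(\partial\Omega)$ given by $\langle\phi,\widetilde\gamma_Nu\rangle_{1/2}=\int_\Omega d^nx\,\overline{\nabla\Phi}\cdot\nabla u+\int_\Omega d^nx\,\overline\Phi\,\Delta u$ for all $\phi\in H^{1/2}(\partial\Omega)$ and any $\Phi\in H^1(\Omega)$ with $\gamma_D\Phi=\phi$. $-\Delta_{\Theta,\Omega}=-\Delta$ with domain $\{u\in H^1(\Omega)\,|\,\Delta u\in L^2(\Omega;d^nx);\ (\widetilde\gamma_N+\widetilde\Theta\gamma_D)u=0\text{ in }H^{-1/2}(\partial\Omega)\}$ and $-\Delta_{D,\Omega}=-\Delta$ with domain $\{u\in H^1(\Omega)\,|\,\Delta u\in L^2(\Omega;d^nx);\ \gamma_Du=0\}$ are the (self-adjoint) generalized Robin and Dirichlet Laplacians in $L^2(\Omega;d^nx)$. One has $\widetilde\gamma_N(-\Delta_{D,\Omega}-zI_\Omega)^{-1}\in\mathcal{B}(L^2(\Omega;d^nx),L^2(\partial\Omega;d^{n-1}\omega))$, and $[\widetilde\gamma_N(-\Delta_{D,\Omega}-\overline zI_\Omega)^{-1}]^*\in\mathcal{B}(L^2(\partial\Omega;d^{n-1}\omega),L^2(\Omega;d^nx))$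 is the Hilbert space adjoint. Robin-to-Dirichlet map: for $z\notin\sigma(-\Delta_{\Theta,\Omega})$, $M^{(0)}_{\Theta,D,\Omega}(z)\colon L^2(\partial\Omega;d^{n-1}\omega)\to H^1(\partial\Omega)\hookrightarrow L^2(\partial\Omega;d^{n-1}\omega)$, $g\mapsto\gamma_Du_\Theta$, where $u_\Theta$ is the unique solution of $(-\Delta-z)u=0$ in $\Omega$, $u\in H^{3/2}(\Omega)$, $(\widetilde\gamma_N+\widetilde\Theta\gamma_D)u=g$ on $\partial\Omega$. *)

(* Defs.v *)
(* Throughout, functions are honest functions on 'rV[R]_n with values in R[i];
   elements of L2 and Sobolev spaces are such functions up to a.e. equality, so
   identities in these spaces are stated a.e. and a function attached to a
   set D is only looked at on D. *)
From HB Require Import structures.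
From mathcomp Require Import all_boot all_order all_algebra.
From mathcomp Require Import complex.
From mathcomp Require Import all_classical all_reals all_analysis.

Set Implicit Arguments.
Unset Strict Implicit.
Unset Printing Implicit Defensive.

Import Order.TTheory GRing.Theory Num.Theory.
Import numFieldNormedType.Exports.

Local Open Scope classical_set_scope.
Local Open Scope ring_scope.

Section cover_outer.
Local Open Scope ereal_scope.
Context (R : realType) (T : pointedType) (w : set T -> \bar R).

Definition cover_outer (A : set T) : \bar R :=
  ereal_inf [set \sum_(k <oo) w (F k) | F in
    [set F : (set T)^nat | A `<=` \bigcup_k F k]].

Hypotheses (w0 : w set0 = 0) (w_ge0 : forall A, 0 <= w A).

Let D : Type := g_sigma_algebraType (@setT (set T)).
Let wD : set (g_sigma_algebraType (@setT (set T))) -> \bar R := w.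

Let cover_outerE : cover_outer = mu_ext wD.
Proof.
apply/funext => A; rewrite /cover_outer /mu_ext; congr (ereal_inf _).
apply/seteqP; split => _ [F /= HF <-]; exists F => //.
  by split => // i; exact: sub_sigma_algebra.
by case: HF.
Qed.

Lemma cover_outer0 : cover_outer set0 = 0.
Proof. by rewrite cover_outerE; exact: mu_ext0. Qed.

Lemma cover_outer_ge0 A : 0 <= cover_outer A.
Proof. by rewrite cover_outerE; exact: mu_ext_ge0. Qed.

Lemma le_cover_outer : {homo cover_outer : A B / A `<=` B >-> A <= B}.
Proof. by move=> A B AB; rewrite !cover_outerE; exact: (le_mu_ext wD AB). Qed.

Lemma cover_outer_sigma_subadditive : sigma_subadditive cover_outer.
Proof. by rewrite cover_outerE; exact: (@mu_ext_sigma_subadditive _ _ _ wD). Qed.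

End cover_outer.

Section lebesgue_rV.
Context (R : realType) (n : nat).
Implicit Types (A : set 'rV[R]_n).

Definition closed_box (a b : 'rV[R]_n) : set 'rV[R]_n :=
  [set x | forall i, a 0 i <= x 0 i <= b 0 i].

(* The volume of the smallest closed box containing A; the empty set is
   singled out because of the case n = 0. *)
Definition box_volume A : \bar R :=
  if `[< A = set0 >] then 0%E else
  ereal_inf [set (\prod_i (p.2 0 i - p.1 0 i))%:E | p in
    [set p : 'rV[R]_n * 'rV[R]_n |
      (forall i, p.1 0 i <= p.2 0 i) /\ A `<=` closed_box p.1 p.2]].

Lemma box_volume0 : box_volume set0 = 0%E.
Proof. by rewrite /box_volume; case: asboolP. Qed.

Lemma box_volume_ge0 A : (0 <= box_volume A)%E.
Proof.
rewrite /box_volume; case: asboolP => // _.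
apply: le_ereal_inf_tmp => _ [p /= [p12 _] <-].
by rewrite lee_fin prodr_ge0// => i _; rewrite subr_ge0.
Qed.

Let box_cover : set 'rV[R]_n -> \bar R := cover_outer box_volume.

HB.instance Definition _ := isOuterMeasure.Build R 'rV[R]_n box_cover
  (cover_outer0 box_volume0 box_volume_ge0) (cover_outer_ge0 box_volume_ge0)
  (le_cover_outer box_volume) (cover_outer_sigma_subadditive box_volume_ge0).

Definition lebesgue_outer : {outer_measure set 'rV[R]_n -> \bar R} := box_cover.

(* The sigma-algebra is that of Lebesgue measurable sets. *)
Definition lebesgue_rV :
    {measure set (caratheodory_type lebesgue_outer) -> \bar R} :=
  lebesgue_outer.

End lebesgue_rV.
Arguments lebesgue_outer R n : clear implicits.
Arguments lebesgue_rV R n : clear implicits.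

Section hausdorff.
Context (R : realType) (n : nat).
Implicit Types (A : set 'rV[R]_n).

(* The norm `|x| of 'rV[R]_n is the sup norm. *)
Definition enorm (x : 'rV[R]_n) : R := Num.sqrt (\sum_i x 0 i ^+ 2).

Definition ediam A : \bar R :=
  ereal_sup [set (enorm (p.1 - p.2))%:E | p in [set p | A p.1 /\ A p.2]].

End hausdorff.

Section hausdorff_measure.
Context (R : realType) (m n : nat).
Implicit Types (A : set 'rV[R]_n).

(* The volume of the unit ball of R^m, the usual normalisation, for which
   the m-dimensional Hausdorff measure of R^m is Lebesgue measure. *)
Definition unit_ball_volume : R :=
  fine (lebesgue_outer R m [set x | enorm x <= 1]).

Definition hausdorff_weight (delta : R) A : \bar R :=
  if `[< A = set0 >] then 0%E else
  if `[< (ediam A <= delta%:E)%E >] then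
    (unit_ball_volume * (fine (ediam A) / 2) ^+ m)%:E
  else +oo%E.

Lemma hausdorff_weight0 delta : hausdorff_weight delta set0 = 0%E.
Proof. by rewrite /hausdorff_weight; case: asboolP. Qed.

Lemma hausdorff_weight_ge0 delta A : (0 <= hausdorff_weight delta A)%E.
Proof.
rewrite /hausdorff_weight; case: asboolP => // /eqP/set0P[x Ax].
case: asboolP => // _; rewrite lee_fin mulr_ge0 ?exprn_ge0 ?divr_ge0//.
  exact/fine_ge0/outer_measure_ge0.
apply: fine_ge0; apply: (@le_trans _ _ (enorm (x - x))%:E).
  by rewrite lee_fin sqrtr_ge0.
by apply: ereal_sup_ubound; exists (x, x).
Qed.

Let hausdorff_cover A : \bar R :=
  ereal_sup [set cover_outer (hausdorff_weight delta) A |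
    delta in [set delta : R | 0 < delta]].

Let hausdorff_cover0 : hausdorff_cover set0 = 0%E.
Proof.
apply/eqP; rewrite eq_le; apply/andP; split.
  apply: ge_ereal_sup => _ [delta _ <-].
  by rewrite (cover_outer0 (hausdorff_weight0 _) (hausdorff_weight_ge0 _)).
apply: ereal_sup_ubound; exists 1 => //=.
exact: (cover_outer0 (hausdorff_weight0 _) (hausdorff_weight_ge0 _)).
Qed.

Let hausdorff_cover_ge0 A : (0 <= hausdorff_cover A)%E.
Proof.
apply: le_trans (cover_outer_ge0 (hausdorff_weight_ge0 1) A) _.
by apply: ereal_sup_ubound; exists 1 => /=.
Qed.

Let le_hausdorff_cover : {homo hausdorff_cover : A B / A `<=` B >-> (A <= B)%E}.
Proof.
move=> A B AB; apply: ge_ereal_sup => _ [delta d0 <-].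
apply: le_trans (le_cover_outer _ AB) _.
by apply: ereal_sup_ubound; exists delta => /=.
Qed.

Let hausdorff_cover_sigma_subadditive : sigma_subadditive hausdorff_cover.
Proof.
move=> F; apply: ge_ereal_sup => _ [delta d0 <-].
apply: le_trans
  (cover_outer_sigma_subadditive (hausdorff_weight_ge0 delta) F) _.
apply: lee_nneseries => [i _ _|i _]; first exact/cover_outer_ge0/hausdorff_weight_ge0.
by apply: ereal_sup_ubound; exists delta => /=.
Qed.

HB.instance Definition _ := isOuterMeasure.Build R 'rV[R]_n hausdorff_cover
  hausdorff_cover0 hausdorff_cover_ge0 le_hausdorff_cover
  hausdorff_cover_sigma_subadditive.

Definition hausdorff_outer : {outer_measure set 'rV[R]_n -> \bar R} :=
  hausdorff_cover.

Definition hausdorff_measure :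
    {measure set (caratheodory_type hausdorff_outer) -> \bar R} :=
  hausdorff_outer.

End hausdorff_measure.
Arguments hausdorff_outer R m n : clear implicits.
Arguments hausdorff_measure R m n : clear implicits.

(* On the boundary of a Lipschitz domain of R^n the surface measure is the
   (n-1)-dimensional Hausdorff measure. *)
Notation surface_measure R n := (hausdorff_measure R n.-1 n).

Section L2.
Context d (X : measurableType d) (R : realType).
Variables (mu : {measure set X -> \bar R}) (D : set X).
Implicit Types f g : X -> R[i].

Definition sqnormc (z : R[i]) : R := complex.Re z ^+ 2 + complex.Im z ^+ 2.

Definition cintegral f : R[i] :=
  (Rintegral mu D (fun x => complex.Re (f x)) +i*
   Rintegral mu D (fun x => complex.Im (f x)))%C.

Definition L2sqnorm f : \bar R := (\int[mu]_(x in D) (sqnormc (f x))%:E)%E.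

Definition L2 : set (X -> R[i]) := [set f |
  [/\ measurable_fun D (fun x => complex.Re (f x)),
      measurable_fun D (fun x => complex.Im (f x)) &
      (L2sqnorm f < +oo)%E]].

Definition L2dot f g : R[i] := cintegral (fun x => (f x)^*%C * g x).

End L2.

Section L2_operators.
Context d1 d2 (X1 : measurableType d1) (X2 : measurableType d2) (R : realType).
Variables (mu1 : {measure set X1 -> \bar R}) (D1 : set X1).
Variables (mu2 : {measure set X2 -> \bar R}) (D2 : set X2).

Definition bounded_op (T : (X1 -> R[i]) -> (X2 -> R[i])) : Prop :=
  [/\ forall f, L2 mu1 D1 f -> L2 mu2 D2 (T f),
      forall (c : R[i]) f g, L2 mu1 D1 f -> L2 mu1 D1 g ->
        ae_eq mu2 D2 (T (fun x => c * f x + g x)) (fun y => c * T f y + T g y) &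
      exists C : R, forall f, L2 mu1 D1 f ->
        (L2sqnorm mu2 D2 (T f) <= C%:E * L2sqnorm mu1 D1 f)%E].

(* The Hilbert space adjoint, given by the Riesz representation. *)
Definition adjoint_op (T : (X1 -> R[i]) -> (X2 -> R[i])) (g : X2 -> R[i]) :
    X1 -> R[i] :=
  xget (fun=> 0) [set w | L2 mu1 D1 w /\
    forall f, L2 mu1 D1 f -> L2dot mu1 D1 w f = L2dot mu2 D2 g (T f)].

End L2_operators.

(* An operator in L2 is given by its graph: A u w means that u is in the
   domain of A and A u = w. *)
Section unbounded_operators.
Context d (X : measurableType d) (R : realType).
Variables (mu : {measure set X -> \bar R}) (D : set X).
Variable A : (X -> R[i]) -> (X -> R[i]) -> Prop.

(* S is the bounded, everywhere defined inverse of A - z. *)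
Definition is_resolvent (z : R[i]) (S : (X -> R[i]) -> (X -> R[i])) : Prop :=
  [/\ bounded_op mu D mu D S,
      forall f, L2 mu D f -> A (S f) (fun x => f x + z * S f x) &
      forall u w, A u w -> ae_eq mu D (S (fun x => w x - z * u x)) u].

Definition spectrum : set R[i] := [set z | ~ exists S, is_resolvent z S].

(* (A - z)^-1, meaningful when z is not in the spectrum. *)
Definition resolvent (z : R[i]) : (X -> R[i]) -> (X -> R[i]) :=
  xget (id : (X -> R[i]) -> (X -> R[i])) [set S | is_resolvent z S].

End unbounded_operators.

Section weak_derivatives.
Context (R : realType) (n : nat).
Local Notation leb := (lebesgue_rV R n).
Implicit Types (D : set 'rV[R]_n) (u w g : 'rV[R]_n -> R[i]).

Definition partial (i : 'I_n) (f : 'rV[R]_n -> R) : 'rV[R]_n -> R :=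
  fun x => 'D_(delta_mx 0 i) f x.

Fixpoint Ck (k : nat) (f : 'rV[R]_n -> R) : Prop :=
  continuous f /\
  if k is k'.+1 then
    forall i, (forall x, derivable f x (delta_mx 0 i)) /\ Ck k' (partial i f)
  else True.

Definition test_fun D (f : 'rV[R]_n -> R) : Prop :=
  (forall k, Ck k f) /\
  exists K : set 'rV[R]_n,
    [/\ compact K, K `<=` D & forall x, ~ K x -> f x = 0].

Definition ctest_fun D (f : 'rV[R]_n -> R[i]) : Prop :=
  test_fun D (fun x => complex.Re (f x)) /\
  test_fun D (fun x => complex.Im (f x)).

Definition weak_partial D (i : 'I_n) u g : Prop :=
  forall phi, test_fun D phi ->
    cintegral leb D (fun x => u x * (partial i phi x)%:C%C) =
    - cintegral leb D (fun x => g x * (phi x)%:C%C).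

Definition weak_gradient D u (G : 'I_n -> 'rV[R]_n -> R[i]) : Prop :=
  forall i, L2 leb D (G i) /\ weak_partial D i u (G i).

(* Laplacian u = w in D, in the sense of distributions. *)
Definition weak_laplacian D u w : Prop :=
  forall phi, test_fun D phi ->
    cintegral leb D (fun x => u x * (\sum_i partial i (partial i phi) x)%:C%C) =
    cintegral leb D (fun x => w x * (phi x)%:C%C).

Definition gagliardo_sqnorm (sigma : R) u : \bar R :=
  if sigma == 0 then 0%E else
  (\int[leb]_x \int[leb]_y
    (sqnormc (u x - u y) / enorm (x - y) `^ (n%:R + 2 * sigma))%:E)%E.

(* The squared norm of order k + sigma, 0 <= sigma < 1.  The weak gradient is
   unique up to null sets, so that the infimum runs over one value if u has
   a weak gradient in L2, and is +oo otherwise. *)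
Fixpoint sobolev_sqnorm_rec (k : nat) (sigma : R) u : \bar R :=
  (L2sqnorm leb setT u +
   if k is k'.+1 then
     ereal_inf [set \sum_(i < n) sobolev_sqnorm_rec k' sigma (G i) |
       G in [set G | weak_gradient setT u G]]
   else gagliardo_sqnorm sigma u)%E.

Definition sobolev_sqnorm (s : R) : ('rV[R]_n -> R[i]) -> \bar R :=
  sobolev_sqnorm_rec (Num.trunc s) (s - (Num.trunc s)%:R).

Definition sobolev (s : R) : set ('rV[R]_n -> R[i]) :=
  [set u | L2 leb setT u /\ (sobolev_sqnorm s u < +oo)%E].

Definition sobolev_on (s : R) D : set ('rV[R]_n -> R[i]) :=
  [set u | exists2 U, sobolev s U & ae_eq leb D u U].

End weak_derivatives.

Section lipschitz_domains.
Context (R : realType) (n : nat).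

Definition frontier (D : set 'rV[R]_n) : set 'rV[R]_n := closure D `\` interior D.

(* In an open set nbhd, the rigid motion given by chart_rot and chart_org turns
   the domain into the region above the graph of chart_fun. *)
Record chart := Chart {
  chart_nbhd : set 'rV[R]_n ;
  chart_rot : 'M[R]_n ;
  chart_org : 'rV[R]_n ;
  chart_fun : 'rV[R]_n.-1 -> R }.

(* The point (y, t) of R^(n-1) x R. *)
Definition pair_rV (y : 'rV[R]_n.-1) (t : R) : 'rV[R]_n :=
  \row_(i < n) oapp (fun j : 'I_n.-1 => y 0 j) t (insub (val i)).

Definition chart_pt (c : chart) (y : 'rV[R]_n.-1) (t : R) : 'rV[R]_n :=
  chart_org c + pair_rV y t *m chart_rot c.

Definition chart_graph (c : chart) (y : 'rV[R]_n.-1) : 'rV[R]_n :=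
  chart_pt c y (chart_fun c y).

Definition lipschitz_chart (D : set 'rV[R]_n) (c : chart) : Prop :=
  [/\ open (chart_nbhd c),
      chart_rot c *m (chart_rot c)^T = 1%:M,
      exists L : R, forall x y,
        `|chart_fun c x - chart_fun c y| <= L * enorm (x - y) &
      forall y t, chart_nbhd c (chart_pt c y t) ->
        (D (chart_pt c y t) <-> chart_fun c y < t)].

(* Charts together with cut-off functions, used to define the Sobolev spaces
   on the boundary. *)
Record atlas := Atlas {
  atlas_size : nat ;
  atlas_chart : 'I_atlas_size -> chart ;
  atlas_cutoff : 'I_atlas_size -> 'rV[R]_n -> R }.

Definition lipschitz_cover (D : set 'rV[R]_n) K (c : 'I_K -> chart) : Prop :=
  (forall j, lipschitz_chart D (c j)) /\
  frontier D `<=` \bigcup_j chart_nbhd (c j).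

Definition lipschitz_domain (D : set 'rV[R]_n) : Prop :=
  exists K (c : 'I_K -> chart), lipschitz_cover D c.

Definition boundary_atlas (D : set 'rV[R]_n) (A : atlas) : Prop :=
  [/\ lipschitz_cover D (@atlas_chart A),
      forall j, test_fun (chart_nbhd (atlas_chart j)) (@atlas_cutoff A j),
      forall j x, 0 <= @atlas_cutoff A j x &
      forall x, frontier D x -> \sum_j @atlas_cutoff A j x = 1].

End lipschitz_domains.
Arguments chart R n : clear implicits.
Arguments atlas R n : clear implicits.

Section boundary_value_problems.
Context (R : realType) (n : nat).
Variables (Omega : set 'rV[R]_n) (At : atlas R n).
Local Notation func := ('rV[R]_n -> R[i]).
Local Notation leb := (lebesgue_rV R n).
Local Notation surf := (surface_measure R n).
Local Notation bd := (frontier Omega).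

Definition L2_dom : set func := L2 leb Omega.
Definition L2_bd : set func := L2 surf bd.
Definition dot_bd (f g : func) : R[i] := L2dot surf bd f g.

Definition boundary_piece (j : 'I_(atlas_size At)) (f : func) :
    'rV[R]_n.-1 -> R[i] :=
  fun y => let p := chart_graph (atlas_chart j) y in
    (@atlas_cutoff _ _ At j p)%:C%C * f p.

Definition sobolev_bd_sqnorm (s : R) (f : func) : \bar R :=
  (\sum_(j < atlas_size At) sobolev_sqnorm s (boundary_piece j f))%E.

Definition sobolev_bd (s : R) : set func :=
  [set f | L2_bd f /\ forall j, sobolev s (boundary_piece j f)].

Local Notation Hhalf := (sobolev_bd (1 / 2)).
Local Notation Hhalf_sqnorm := (sobolev_bd_sqnorm (1 / 2)).

(* H^(-1/2) of the boundary; the pairing of f and psi is psi f. *)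
Definition sobolev_bd_dual : set (func -> R[i]) :=
  [set psi |
    (forall (c : R[i]) f g, Hhalf f -> Hhalf g ->
      psi (fun x => c * f x + g x) = c^*%C * psi f + psi g) /\
    exists C : R, forall f, Hhalf f ->
      ((sqnormc (psi f))%:E <= C%:E * Hhalf_sqnorm f)%E].

(* f is the Dirichlet trace of u in H^1(Omega).  The graph of the trace
   H^1(Omega) -> H^(1/2) is the closure of the graph of the restriction to the
   boundary on smooth functions. *)
Definition dirichlet_trace (u f : func) : Prop :=
  Hhalf f /\
  exists U : func, exists phi : nat -> func,
    [/\ sobolev 1 U, ae_eq leb Omega u U,
        forall k, ctest_fun setT (phi k),
        (fun k => sobolev_sqnorm 1 (fun x => phi k x - U x)) @ \oo --> 0%E &
        (fun k => Hhalf_sqnorm (fun x => phi k x - f x)) @ \oo --> 0%E].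

(* psi is the weak Neumann trace of u in H^1(Omega), where Laplacian u = w is
   in L2. *)
Definition neumann_trace (u w : func) (psi : func -> R[i]) : Prop :=
  [/\ sobolev_on 1 Omega u, L2_dom w /\ weak_laplacian Omega u w,
      sobolev_bd_dual psi &
      forall Phi f : func, sobolev_on 1 Omega Phi -> dirichlet_trace Phi f ->
      forall GPhi Gu,
        weak_gradient Omega Phi GPhi -> weak_gradient Omega u Gu ->
        psi f = \sum_(i < n) L2dot leb Omega (GPhi i) (Gu i) +
                L2dot leb Omega Phi w].

Definition dirichlet_laplacian (u w : func) : Prop :=
  [/\ sobolev_on 1 Omega u, L2_dom w,
      weak_laplacian Omega u (fun x => - w x) & dirichlet_trace u (fun=> 0)].

(* N = neumann_trace (- Laplacian_D - z)^-1, as a bounded operator from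
   L2(Omega) to L2 of the boundary. *)
Definition is_neumann_resolvent (z : R[i]) (N : func -> func) : Prop :=
  bounded_op leb Omega surf bd N /\
  forall f, L2_dom f ->
    let u := resolvent leb Omega dirichlet_laplacian z f in
    exists2 psi, neumann_trace u (fun x => - (f x + z * u x)) psi &
      forall h, Hhalf h -> psi h = dot_bd h (N f).

Section robin.
Variable Theta : func -> func -> R[i].

(* -Laplacian with the boundary condition
   neumann_trace u + Theta (dirichlet_trace u) = 0 in H^(-1/2). *)
Definition robin_laplacian (u w : func) : Prop :=
  L2_dom w /\
  exists f psi, [/\ dirichlet_trace u f, neumann_trace u (fun x => - w x) psi &
    forall h, Hhalf h -> psi h + Theta f h = 0].

(* u in H^(3/2)(Omega) solves (-Laplacian - z) u = 0 in Omega with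
   neumann_trace u + Theta (dirichlet_trace u) = g, where g is in L2 of the
   boundary and f is the Dirichlet trace of u. *)
Definition robin_solution (z : R[i]) (g u f : func) : Prop :=
  [/\ sobolev_on (3 / 2) Omega u, dirichlet_trace u f &
      exists2 psi, neumann_trace u (fun x => - (z * u x)) psi &
        forall h, Hhalf h -> psi h + Theta f h = dot_bd h g].

Definition is_robin_to_dirichlet (z : R[i]) (M : func -> func) : Prop :=
  forall g, L2_bd g -> sobolev_bd 1 (M g) /\
    exists u, robin_solution z g u (M g) /\
      forall u' f', robin_solution z g u' f' -> ae_eq leb Omega u' u.

End robin.

(* A sesquilinear form with domain H^(1/2) x H^(1/2), antilinear in the first
   factor; the last clause makes it well defined on classes of functions. *)
Definition form_sesquilinear (a : func -> func -> R[i]) : Prop :=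
  [/\ forall (c : R[i]) f g h, Hhalf f -> Hhalf g -> Hhalf h ->
        a (fun x => c * f x + g x) h = c^*%C * a f h + a g h,
      forall (c : R[i]) f g h, Hhalf f -> Hhalf g -> Hhalf h ->
        a h (fun x => c * f x + g x) = c * a h f + a h g &
      forall f f' g g', Hhalf f -> Hhalf f' -> Hhalf g -> Hhalf g' ->
        ae_eq surf bd f f' -> ae_eq surf bd g g' -> a f g = a f' g'].

Definition form_symmetric (a : func -> func -> R[i]) : Prop :=
  forall f g, Hhalf f -> Hhalf g -> a f g = (a g f)^*%C.

Definition form_bounded_below (a : func -> func -> R[i]) (c : R) : Prop :=
  forall f, Hhalf f ->
    c * fine (L2sqnorm surf bd f) <= complex.Re (a f f).

Definition form_sqnorm (a : func -> func -> R[i]) (c : R) (f : func) : R :=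
  complex.Re (a f f) + (1 - c) * fine (L2sqnorm surf bd f).

Definition form_closed (a : func -> func -> R[i]) (c : R) : Prop :=
  forall f : nat -> func, (forall k, Hhalf (f k)) ->
    (forall e : R, 0 < e -> exists N, forall k l, (N <= k)%N -> (N <= l)%N ->
      form_sqnorm a c (fun x => f k x - f l x) < e) ->
    exists2 g, Hhalf g &
      (fun k => form_sqnorm a c (fun x => f k x - g x)) @ \oo --> (0 : R).

Definition bounded_half (Theta : func -> func -> R[i]) : Prop :=
  [/\ forall g, Hhalf g -> sobolev_bd_dual (Theta g),
      forall (c : R[i]) f g h, Hhalf f -> Hhalf g -> Hhalf h ->
        Theta (fun x => c * f x + g x) h = c * Theta f h + Theta g h &
      exists C : R, forall f g, Hhalf f -> Hhalf g ->
        ((sqnormc (Theta g f))%:E <= C%:E * Hhalf_sqnorm g * Hhalf_sqnorm f)%E].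

Definition associated_operator (a : func -> func -> R[i])
    (Theta : func -> func -> R[i]) : Prop :=
  forall f g, Hhalf f -> Hhalf g -> Theta g f = a f g.

(* Theta maps H^1 compactly into L2 of the boundary, L2 being a subspace of
   H^(-1/2) through the pairing. *)
Definition compact_H1_L2 (Theta : func -> func -> R[i]) : Prop :=
  exists T : func -> func,
    (forall g, sobolev_bd 1 g -> L2_bd (T g) /\
      forall h, Hhalf h -> Theta g h = dot_bd h (T g)) /\
    forall g : nat -> func, (forall k, sobolev_bd 1 (g k)) ->
      (exists C : R, forall k, (sobolev_bd_sqnorm 1 (g k) <= C%:E)%E) ->
      exists sigma : nat -> nat, exists f : func,
        [/\ {homo sigma : k l / (k < l)%N}, L2_bd f &
          (fun k => L2sqnorm surf bd (fun x => T (g (sigma k)) x - f x))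
            @ \oo --> 0%E].

End boundary_value_problems.

(* Main.v *)
(* By uniqueness in the Robin resolvent equation it is enough to exhibit the
   right-hand side, applied to f, as an element y of the Robin domain with
   (- Laplacian - z) y = f.  Let uD be the Dirichlet resolvent of f, and u the
   Robin solution with boundary datum N f, so that the Dirichlet trace of u is
   M (N f).  The Robin boundary terms of uD and u are both N f, hence cancel in
   y := uD - u, and Green's second identity identifies the adjoint of Nbar at
   M (N f) with - u.  The latter uses the Dirichlet resolvent at conj z, which
   is obtained from the one at z by complex conjugation. *)
Require Import Defs.
From HB Require Import structures.
From mathcomp Require Import all_boot all_order all_algebra.
From mathcomp Require Import complex.
From mathcomp Require Import all_classical all_reals all_analysis.
From mathcomp Require Import measurable_realfun ring lra.

Set Implicit Arguments.
Unset Strict Implicit.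
Unset Printing Implicit Defensive.

Import Order.TTheory GRing.Theory Num.Theory.
Import numFieldNormedType.Exports.

Local Open Scope classical_set_scope.
Local Open Scope ring_scope.

(** Traces, weak derivatives and Sobolev norms are relations and extended-real functionals on honest
    functions. The labour therefore lies in showing that they survive the two operations applied to
    solutions, subtraction and conjugation. The trace of a difference comes from subtracting the
    approximating smooth sequences, and so needs a triangle inequality for squared norms. It is used
    in the form [h <= 2 * (f + g)], which holds pointwise by the parallelogram identity and passes
    through integrals, finite sums, infima over weak gradients and limits equal to 0, without any
    square root. Integrating it asks for measurable integrands, among them the Gagliardo kernels and
    the smooth functions pulled back to the boundary charts. This is why measurability of open sets
    and sigma-finiteness are derived from the definition of Lebesgue measure by box covers. *)

Lemma ge0_integral_le2D d (X : measurableType d) (R : realType)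
    (mu : {measure set X -> \bar R}) (D : set X) (f g h : X -> \bar R) :
  measurable D ->
  (forall x, 0 <= f x)%E -> (forall x, 0 <= g x)%E -> (forall x, 0 <= h x)%E ->
  measurable_fun D f -> measurable_fun D g -> measurable_fun D h ->
  (forall x, h x <= 2%:E * (f x + g x))%E ->
  (\int[mu]_(x in D) h x
     <= 2%:E * (\int[mu]_(x in D) f x + \int[mu]_(x in D) g x))%E.
Proof.
move=> mD f0 g0 h0 mf mg mh hfg.
rewrite -ge0_integralD// -ge0_integralZl//; last 2 first.
- exact: emeasurable_funD.
- by move=> x _; exact: adde_ge0.
apply: ge0_le_integral => //.
by apply: measurable_funeM; exact: emeasurable_funD.
Qed.

(** * Arithmetic of the squared modulus *)

Section complex_numbers.
Context (R : realType).
Implicit Types a b c d x y : R[i].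

Lemma sqnormc_ge0 x : 0 <= sqnormc x.
Proof. by rewrite addr_ge0// sqr_ge0. Qed.

Lemma sqnormc_eq0 x : sqnormc x = 0 -> x = 0.
Proof.
case: x => a b /eqP; rewrite /sqnormc /= paddr_eq0 ?sqr_ge0//.
by rewrite !sqrf_eq0 => /andP[/eqP -> /eqP ->].
Qed.

(** Parallelogram identity: the two sides differ by [sqnormc (x + y)]. *)
Lemma sqnormcB_le x y : sqnormc (x - y) <= 2 * (sqnormc x + sqnormc y).
Proof.
case: x y => [a b] [c d]; rewrite /sqnormc /= -subr_ge0.
have -> : 2 * (a ^+ 2 + b ^+ 2 + (c ^+ 2 + d ^+ 2)) -
   ((a - c) ^+ 2 + (b - d) ^+ 2) = (a + c) ^+ 2 + (b + d) ^+ 2 by ring.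
by rewrite addr_ge0// sqr_ge0.
Qed.

(** Regrouping for the Gagliardo kernel of a difference: [a], [b] are the values of one function at
    two points, [c], [d] those of the other. *)
Lemma sqnormc_subACA_le a b c d :
  sqnormc (a - c - (b - d)) <= 2 * (sqnormc (a - b) + sqnormc (c - d)).
Proof.
have -> : a - c - (b - d) = (a - b) - (c - d) by ring.
exact: sqnormcB_le.
Qed.

Lemma sqnormc_conj x : sqnormc x^*%C = sqnormc x.
Proof. by case: x => a b; rewrite /sqnormc /= sqrrN. Qed.

Lemma sqnormcM x y : sqnormc (x * y) = sqnormc x * sqnormc y.
Proof. by case: x y => [a b] [c d]; rewrite /sqnormc /=; ring. Qed.

Lemma sqnormcN x : sqnormc (- x) = sqnormc x.
Proof. by case: x => a b; rewrite /sqnormc /= !sqrrN. Qed.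

Lemma Re_mulc x y : complex.Re (x * y) =
  complex.Re x * complex.Re y - complex.Im x * complex.Im y.
Proof. by case: x y => [a b] [c d]. Qed.

Lemma Im_mulc x y : complex.Im (x * y) =
  complex.Re x * complex.Im y + complex.Im x * complex.Re y.
Proof. by case: x y => [a b] [c d]. Qed.

Lemma Re_subc x y : complex.Re (x - y) = complex.Re x - complex.Re y.
Proof. by case: x y => [a b] [c d]. Qed.

Lemma Im_subc x y : complex.Im (x - y) = complex.Im x - complex.Im y.
Proof. by case: x y => [a b] [c d]. Qed.

Lemma Re_conjc x : complex.Re x^*%C = complex.Re x.
Proof. by case: x. Qed.

Lemma Im_conjc x : complex.Im x^*%C = - complex.Im x.
Proof. by case: x. Qed.

Lemma complex_eqP x y : complex.Re x = complex.Re y ->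
  complex.Im x = complex.Im y -> x = y.
Proof. by case: x y => [a b] [c d] /= -> ->. Qed.

End complex_numbers.

(** * Complex-valued integrals *)

Section complex_integral.
Context d (X : measurableType d) (R : realType).
Variables (mu : {measure set X -> \bar R}).
Implicit Types (D : set X) (f g h : X -> R[i]).

Definition cintegrable D f : Prop :=
  mu.-integrable D (EFin \o (fun x => complex.Re (f x))) /\
  mu.-integrable D (EFin \o (fun x => complex.Im (f x))).

Lemma cintegralB D f g : measurable D ->
  cintegrable D f -> cintegrable D g ->
  cintegral mu D (fun x => f x - g x) = cintegral mu D f - cintegral mu D g.
Proof.
move=> mD [fr fi] [gr gi]; rewrite /cintegral.
under [X in (X +i* _)%C]eq_Rintegral do rewrite Re_subc.
under [X in (_ +i* X)%C]eq_Rintegral do rewrite Im_subc.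
by rewrite !RintegralB.
Qed.

Lemma cintegralZ D (c : R[i]) f : measurable D -> cintegrable D f ->
  cintegral mu D (fun x => c * f x) = c * cintegral mu D f.
Proof.
move=> mD [fr fi]; rewrite /cintegral.
have Z r k : mu.-integrable D (EFin \o k) ->
    mu.-integrable D (EFin \o (fun x => r * k x)).
  by move=> ik; have := @integrableZl _ _ _ mu _ mD r (EFin \o k) ik.
under [X in (X +i* _)%C]eq_Rintegral do rewrite Re_mulc.
under [X in (_ +i* X)%C]eq_Rintegral do rewrite Im_mulc.
by rewrite RintegralB ?RintegralD ?RintegralZl//; try exact: Z; case: c.
Qed.

Lemma RintegralN D (k : X -> R) : measurable D ->
  mu.-integrable D (EFin \o k) ->
  \int[mu]_(x in D) (- k x) = - \int[mu]_(x in D) k x.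
Proof.
move=> mD ik; rewrite /Rintegral -fineN -integralN//.
exact: (integrable_add_def mD).
Qed.

Lemma cintegral_conj D f : measurable D -> cintegrable D f ->
  cintegral mu D (fun x => (f x)^*%C) = (cintegral mu D f)^*%C.
Proof.
move=> mD [fr fi]; rewrite /cintegral /=.
under [X in (X +i* _)%C]eq_Rintegral do rewrite Re_conjc.
under [X in (_ +i* X)%C]eq_Rintegral do rewrite Im_conjc.
by rewrite RintegralN.
Qed.

Lemma ae_eq_cintegral D f g : measurable D ->
  cintegrable D f -> cintegrable D g -> ae_eq mu D f g ->
  cintegral mu D f = cintegral mu D g.
Proof.
move=> mD [fr fi] [gr gi] fg; rewrite /cintegral /Rintegral.
by congr (fine _ +i* fine _)%C; apply: ae_eq_integral => //;
  do ?[exact: measurable_int fr|exact: measurable_int gr|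
       exact: measurable_int fi|exact: measurable_int gi];
  move: fg; apply: filterS => x + Dx => /(_ Dx) ->.
Qed.

Lemma cintegral_mkcond D E f : D `<=` E -> (forall x, ~ D x -> f x = 0) ->
  cintegral mu D f = cintegral mu E f.
Proof.
move=> DE f0; rewrite /cintegral /Rintegral.
by congr (fine _ +i* fine _)%C; rewrite integral_mkcond [RHS]integral_mkcond;
  apply: eq_integral => x _; rewrite !patchE;
  have [Dx|/negP Dx] := boolP (x \in D);
  try (by rewrite (mem_set (DE _ (set_mem Dx))));
  rewrite f0 ?if_same// => /mem_set.
Qed.

End complex_integral.

(** * Square-integrable functions and their inner product *)

Section L2_theory.
Context d (X : measurableType d) (R : realType).
Variables (mu : {measure set X -> \bar R}).
Implicit Types (D : set X) (f g h : X -> R[i]).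

Lemma L2sqnorm_ge0 D f : (0 <= L2sqnorm mu D f)%E.
Proof. by apply: integral_ge0 => x _; rewrite lee_fin sqnormc_ge0. Qed.

Lemma measurable_sqnormc D f :
  measurable_fun D (fun x => complex.Re (f x)) ->
  measurable_fun D (fun x => complex.Im (f x)) ->
  measurable_fun D (fun x => sqnormc (f x)).
Proof. by move=> fr fi; apply: measurable_funD; exact: measurable_funX. Qed.

Lemma measurable_ReB D f g :
  measurable_fun D (fun x => complex.Re (f x)) ->
  measurable_fun D (fun x => complex.Re (g x)) ->
  measurable_fun D (fun x => complex.Re (f x - g x)).
Proof.
by move=> mf mg; under eq_fun do rewrite Re_subc; exact: measurable_funB.
Qed.

Lemma measurable_ImB D f g :
  measurable_fun D (fun x => complex.Im (f x)) ->
  measurable_fun D (fun x => complex.Im (g x)) ->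
  measurable_fun D (fun x => complex.Im (f x - g x)).
Proof.
by move=> mf mg; under eq_fun do rewrite Im_subc; exact: measurable_funB.
Qed.

Lemma L2sqnormB_le D f g : measurable D ->
  measurable_fun D (fun x => complex.Re (f x)) ->
  measurable_fun D (fun x => complex.Im (f x)) ->
  measurable_fun D (fun x => complex.Re (g x)) ->
  measurable_fun D (fun x => complex.Im (g x)) ->
  (L2sqnorm mu D (fun x => (f x - g x)%R)
     <= 2%:E * (L2sqnorm mu D f + L2sqnorm mu D g))%E.
Proof.
move=> mD fr fi gr gi; apply: ge0_integral_le2D => //=.
- by move=> x; rewrite lee_fin sqnormc_ge0.
- by move=> x; rewrite lee_fin sqnormc_ge0.
- by move=> x; rewrite lee_fin sqnormc_ge0.
- exact/measurable_EFinP/measurable_sqnormc.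
- exact/measurable_EFinP/measurable_sqnormc.
- apply/measurable_EFinP; apply: measurable_sqnormc.
    exact: measurable_ReB.
  exact: measurable_ImB.
- by move=> x; rewrite -EFinD -EFinM lee_fin sqnormcB_le.
Qed.

Lemma L2B D f g : measurable D ->
  L2 mu D f -> L2 mu D g -> L2 mu D (fun x => f x - g x).
Proof.
move=> mD [fr fi foo] [gr gi goo]; split.
- exact: measurable_ReB.
- exact: measurable_ImB.
- apply: le_lt_trans (L2sqnormB_le mD fr fi gr gi) _.
  by rewrite lte_mul_pinfty// ?lee_fin// lte_add_pinfty.
Qed.

Lemma L2sqnormZ D (c : R[i]) f : measurable D -> 
  measurable_fun D (fun x => complex.Re (f x)) ->
  measurable_fun D (fun x => complex.Im (f x)) ->
  L2sqnorm mu D (fun x => c * f x) = ((sqnormc c)%:E * L2sqnorm mu D f)%E.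
Proof.
move=> mD fr fi; rewrite /L2sqnorm -ge0_integralZl//=.
- by apply: eq_integral => x _; rewrite sqnormcM.
- exact/measurable_EFinP/measurable_sqnormc.
- by move=> x _; rewrite lee_fin sqnormc_ge0.
- by rewrite lee_fin sqnormc_ge0.
Qed.

Lemma L2Z D (c : R[i]) f : measurable D -> L2 mu D f -> L2 mu D (fun x => c * f x).
Proof.
move=> mD [fr fi foo]; split.
- under eq_fun do rewrite Re_mulc.
  by apply: measurable_funB; apply: measurable_funM => //; exact: measurable_cst.
- under eq_fun do rewrite Im_mulc.
  by apply: measurable_funD; apply: measurable_funM => //; exact: measurable_cst.
- by rewrite L2sqnormZ// lte_mul_pinfty// lee_fin sqnormc_ge0.
Qed.

Lemma L2N D f : L2 mu D f -> L2 mu D (fun x => - f x).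
Proof.
move=> [fr fi foo]; split.
- under eq_fun do rewrite raddfN; exact: measurableT_comp.
- under eq_fun do rewrite raddfN; exact: measurableT_comp.
- by rewrite /L2sqnorm; under eq_integral do rewrite sqnormcN.
Qed.

Lemma L2D D f g : measurable D ->
  L2 mu D f -> L2 mu D g -> L2 mu D (fun x => f x + g x).
Proof.
move=> mD Lf /L2N Lg; have := L2B mD Lf Lg.
by under [X in L2 _ _ X -> _]eq_fun do rewrite opprK.
Qed.

Lemma L2_0 D : L2 mu D (fun=> 0).
Proof.
split; [exact: measurable_cst|exact: measurable_cst|].
by rewrite /L2sqnorm integral0_eq// => x _; rewrite /sqnormc /= expr0n/= addr0.
Qed.

Lemma L2sqnorm_conj D f : L2sqnorm mu D (fun x => (f x)^*%C) = L2sqnorm mu D f.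
Proof. by rewrite /L2sqnorm; under eq_integral do rewrite sqnormc_conj. Qed.

Lemma L2_conj D f : L2 mu D f -> L2 mu D (fun x => (f x)^*%C).
Proof.
move=> [fr fi foo]; split.
- by under eq_fun do rewrite Re_conjc.
- under eq_fun do rewrite Im_conjc; exact: measurableT_comp.
- by rewrite L2sqnorm_conj.
Qed.

Lemma L2S D E f : measurable E -> measurable D -> D `<=` E ->
  L2 mu E f -> L2 mu D f.
Proof.
move=> mE mD DE [fr fi foo]; split; [exact: measurable_funS fr|exact: measurable_funS fi|].
apply: le_lt_trans foo; apply: ge0_subset_integral => //.
- exact/measurable_EFinP/measurable_sqnormc.
- by move=> x _; rewrite lee_fin sqnormc_ge0.
Qed.

Lemma L2_integrable_sqnormc D f : L2 mu D f ->
  mu.-integrable D (EFin \o (fun x => sqnormc (f x))).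
Proof.
move=> [fr fi foo]; apply/integrableP; split.
  exact/measurable_EFinP/measurable_sqnormc.
by under eq_integral do rewrite /= ger0_norm ?sqnormc_ge0//.
Qed.

(** Both parts of the product are dominated by the sum of the squared moduli, which is
    integrable. *)
Lemma L2_cintegrableM D f g : measurable D ->
  L2 mu D f -> L2 mu D g -> cintegrable mu D (fun x => f x * g x).
Proof.
move=> mD Lf Lg.
have If := L2_integrable_sqnormc Lf; have Ig := L2_integrable_sqnormc Lg.
have IS : mu.-integrable D
    (EFin \o (fun x => sqnormc (f x) + sqnormc (g x))).
  by have := integrableD mD If Ig.
case: Lf Lg => [fr fi _] [gr gi _].
have le x : `|complex.Re (f x * g x)| <= sqnormc (f x) + sqnormc (g x) /\
    `|complex.Im (f x * g x)| <= sqnormc (f x) + sqnormc (g x).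
  case: (f x) (g x) => [a b] [c e]; rewrite /sqnormc /= !ler_norml.
  (* These squares bound the products [a * c], [b * e], [a * e] and [b * c] from both sides. *)
  have := (sqr_ge0 (a + c), sqr_ge0 (a - c), sqr_ge0 (b + e), sqr_ge0 (b - e),
    sqr_ge0 (a + e), sqr_ge0 (a - e), sqr_ge0 (b + c), sqr_ge0 (b - c)).
  move=> [[[[[[[]]]]]]] h1 h2 h3 h4 h5 h6 h7 h8.
  have := (sqr_ge0 a, sqr_ge0 b, sqr_ge0 c, sqr_ge0 e) => -[[[]]] h9 h10 h11 h12.
  by split; apply/andP; split; nra.
split.
- apply: (le_integrable mD _ _ IS).
    apply/measurable_EFinP; under eq_fun do rewrite Re_mulc.
    by apply: measurable_funB; exact: measurable_funM.
  move=> x _ /=; rewrite lee_fin [leRHS]ger0_norm;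
    last exact: (addr_ge0 (sqnormc_ge0 _) (sqnormc_ge0 _)).
  by case: (le x).
- apply: (le_integrable mD _ _ IS).
    apply/measurable_EFinP; under eq_fun do rewrite Im_mulc.
    by apply: measurable_funD; exact: measurable_funM.
  move=> x _ /=; rewrite lee_fin [leRHS]ger0_norm;
    last exact: (addr_ge0 (sqnormc_ge0 _) (sqnormc_ge0 _)).
  by case: (le x).
Qed.

Lemma L2dotBl D f g h : measurable D -> L2 mu D f -> L2 mu D g -> L2 mu D h ->
  L2dot mu D (fun x => f x - g x) h = L2dot mu D f h - L2dot mu D g h.
Proof.
move=> mD Lf Lg Lh; rewrite /L2dot -cintegralB//; last 2 first.
- exact: L2_cintegrableM (L2_conj Lf) Lh.
- exact: L2_cintegrableM (L2_conj Lg) Lh.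
by congr cintegral; apply/funext => x; rewrite rmorphB mulrBl.
Qed.

Lemma L2dotBr D f g h : measurable D -> L2 mu D f -> L2 mu D g -> L2 mu D h ->
  L2dot mu D h (fun x => f x - g x) = L2dot mu D h f - L2dot mu D h g.
Proof.
move=> mD Lf Lg Lh; rewrite /L2dot -cintegralB//; last 2 first.
- exact: L2_cintegrableM (L2_conj Lh) Lf.
- exact: L2_cintegrableM (L2_conj Lh) Lg.
by congr cintegral; apply/funext => x; rewrite mulrBr.
Qed.

Lemma L2dotZr D c f g : measurable D -> L2 mu D f -> L2 mu D g ->
  L2dot mu D f (fun x => c * g x) = c * L2dot mu D f g.
Proof.
move=> mD Lf Lg; rewrite /L2dot -cintegralZ//.
  by congr cintegral; apply/funext => x; rewrite mulrCA.
exact: L2_cintegrableM (L2_conj Lf) Lg.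
Qed.

Lemma L2dotC D f g : measurable D -> L2 mu D f -> L2 mu D g ->
  L2dot mu D f g = (L2dot mu D g f)^*%C.
Proof.
move=> mD Lf Lg; rewrite /L2dot -cintegral_conj//.
  by congr cintegral; apply/funext => x; rewrite rmorphM /= conjcK mulrC.
exact: L2_cintegrableM (L2_conj Lg) Lf.
Qed.

Lemma L2dot_eq0 D f : measurable D -> L2 mu D f -> L2dot mu D f f = 0 ->
  ae_eq mu D f (fun=> 0).
Proof.
move=> mD Lf [] + _.
under eq_Rintegral => x _.
  rewrite Re_mulc Re_conjc Im_conjc mulNr opprK -!expr2.
  over.
move=> f0; have If := L2_integrable_sqnormc Lf; case: Lf => [fr fi foo].
(* The real part of the hypothesis only says that [fine] of this integral is 0, and [fine] also
   sends [+oo] to 0; finiteness is taken from [L2]. *)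
have : (\int[mu]_(x in D) (sqnormc (f x))%:E = 0)%E.
  rewrite -[LHS]fineK; first by rewrite [fine _]f0.
  by rewrite ge0_fin_numE// integral_ge0// => x _; rewrite lee_fin sqnormc_ge0.
move=> I0.
have /(ae_eq_integral_abs mu mD) : measurable_fun D (fun x => (sqnormc (f x))%:E).
  exact/measurable_EFinP/measurable_sqnormc.
case=> + _.
under eq_integral do rewrite gee0_abs ?lee_fin ?sqnormc_ge0//.
rewrite I0 => /(_ erefl); apply: filterS => x + Dx => /(_ Dx) [].
exact: sqnormc_eq0.
Qed.

(** Test with [h := f - g]. This is what determines, up to null sets, the element chosen by
    [adjoint_op]. *)
Lemma L2dot_inj D f g : measurable D -> L2 mu D f -> L2 mu D g ->
  (forall h, L2 mu D h -> L2dot mu D f h = L2dot mu D g h) -> ae_eq mu D f g.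
Proof.
move=> mD Lf Lg fg; have Lfg := L2B mD Lf Lg.
have : L2dot mu D (fun x => f x - g x) (fun x => f x - g x) = 0.
  by rewrite L2dotBl// fg// subrr.
move/(L2dot_eq0 mD Lfg); apply: filterS => x + Dx => /(_ Dx).
exact: subr0_eq.
Qed.

(** Completeness of [mu] keeps a function measurable after a change on a null set; members of
    [sobolev_on] are given only up to such changes. *)
Lemma L2_ae_eq D f g : measure_is_complete mu -> measurable D ->
  ae_eq mu D f g -> L2 mu D f -> L2 mu D g.
Proof.
move=> cmu mD fg [fr fi foo].
have fgr : ae_eq mu D (EFin \o (fun x => complex.Re (f x)))
    (EFin \o (fun x => complex.Re (g x))).
  by apply: filterS fg => x + Dx => /= /(_ Dx) ->.
have fgi : ae_eq mu D (EFin \o (fun x => complex.Im (f x)))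
    (EFin \o (fun x => complex.Im (g x))).
  by apply: filterS fg => x + Dx => /= /(_ Dx) ->.
have gr : measurable_fun D (fun x => complex.Re (g x)).
  apply/measurable_EFinP; apply: (ae_measurable_fun cmu fgr).
  exact/measurable_EFinP.
have gi : measurable_fun D (fun x => complex.Im (g x)).
  apply/measurable_EFinP; apply: (ae_measurable_fun cmu fgi).
  exact/measurable_EFinP.
split=> //; rewrite (_ : L2sqnorm _ _ _ = L2sqnorm mu D f)//.
apply: ge0_ae_eq_integral => //.
- exact/measurable_EFinP/measurable_sqnormc.
- exact/measurable_EFinP/measurable_sqnormc.
- by move=> x _; rewrite lee_fin sqnormc_ge0.
- by move=> x _; rewrite lee_fin sqnormc_ge0.
- by apply: filterS fg => x + Dx => /(_ Dx) ->.
Qed.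

End L2_theory.

(** * From box covers to measurability of open sets and sigma-finiteness *)

Section lebesgue_measurability.
Context (R : realType).

(** Carathéodory's condition can be tested on single covering sets: intersecting a cover of [X] with
    [A] and with its complement gives covers of the two parts of [X], whose weights together do not
    exceed the original ones. *)
Lemma cover_outer_measurable (T : pointedType) (w : set T -> \bar R)
    (w_ge0 : forall A, (0 <= w A)%E) (mu : {outer_measure set T -> \bar R})
    (A : set T) :
  (mu = cover_outer w :> (set T -> \bar R)) ->
  (forall F, w (F `&` A) + w (F `&` ~` A) <= w F)%E ->
  mu.-caratheodory A.
Proof.
move=> muE wA; apply: le_caratheodory_measurable => X; rewrite muE.
apply: le_ereal_inf_tmp => _ [F /= XF <-].
have cov B : (cover_outer w (X `&` B) <= \sum_(k <oo) w (F k `&` B))%E.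
  apply: ereal_inf_lbound; exists (fun k => F k `&` B) => //=.
  by rewrite -setI_bigcupl; exact: setSI.
apply: (@le_trans _ _ (\sum_(k <oo) (w (F k `&` A) + w (F k `&` ~` A)))%E).
  by rewrite nneseriesD//; exact: leeD.
by apply: lee_nneseries => // k _ _; rewrite adde_ge0.
Qed.

Variable n : nat.
Local Notation leb := (lebesgue_rV R n).

Lemma closed_box_volume_le (a b : 'rV[R]_n) (A : set 'rV[R]_n) :
  (forall i, a 0 i <= b 0 i) -> A `<=` closed_box a b ->
  (box_volume A <= (\prod_i (b 0 i - a 0 i))%:E)%E.
Proof.
move=> ab Aab; rewrite /box_volume; case: asboolP => _.
  by rewrite lee_fin prodr_ge0// => i _; rewrite subr_ge0.
by apply: ereal_inf_lbound; exists (a, b).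
Qed.

Lemma halfspace_measurable (i : 'I_n) (t : R) :
  measurable ([set x | x 0 i <= t] : set (caratheodory_type (lebesgue_outer R n))).
Proof.
apply: (cover_outer_measurable (@box_volume_ge0 R n)) => // F.
rewrite {3}/box_volume; case: asboolP => [->|_].
  by rewrite !set0I box_volume0 adde0.
apply: le_ereal_inf_tmp => _ [[a b] /= [ab Fab] <-].
(* If [t] lies outside the [i]-th side of the box, one of the two parts of [F] is empty and the box
   itself encloses the other. *)
have [ta|at_] := ltP t (a 0 i).
  rewrite [X in box_volume X](_ : _ = set0) ?box_volume0 ?add0e; last first.
    apply/seteqP; split => // x [/Fab/(_ i)/andP[/= ax _] /= xt].
    by have := lt_le_trans ta (le_trans ax xt); rewrite ltxx.
  by apply: closed_box_volume_le => //; apply: subset_trans Fab; exact: subIsetl.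
have [bt|tb] := leP (b 0 i) t.
  rewrite [X in (_ + box_volume X)%E](_ : _ = set0) ?box_volume0 ?adde0; last first.
    apply/seteqP; split => // x [/Fab/(_ i)/andP[/= _ xb] /=]; apply.
    exact: le_trans xb bt.
  by apply: closed_box_volume_le => //; apply: subset_trans Fab; exact: subIsetl.
(* The hyperplane cuts the box into one from [a] to [b'] and one from [a'] to [b]. They share every
   side but the [i]-th, whose two lengths add up, so the volumes add up. *)
pose b' : 'rV[R]_n := \row_j (if j == i then t else b 0 j).
pose a' : 'rV[R]_n := \row_j (if j == i then t else a 0 j).
apply: (@le_trans _ _ ((\prod_j (b' 0 j - a 0 j))%:E +
    (\prod_j (b 0 j - a' 0 j))%:E)%E).
  apply: leeD; apply: closed_box_volume_le.
  - by move=> j; rewrite mxE; case: eqP => // ->.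
  - move=> x [/Fab xab /= xt] j; rewrite mxE; have /andP[-> /= xb] := xab j.
    by case: eqP => // ->.
  - by move=> j; rewrite mxE; case: eqP => // ->; exact: ltW.
  - move=> x [/Fab xab /= /negP]; rewrite -ltNge => xt j.
    by rewrite mxE; have /andP[ax ->] := xab j; rewrite andbT; case: eqP => // ->; exact: ltW.
rewrite -EFinD lee_fin (bigD1 i)//= [X in _ + X](bigD1 i)//= [leRHS](bigD1 i)//=.
rewrite !mxE eqxx.
rewrite (eq_bigr (fun j => b 0 j - a 0 j)); last first.
  by move=> j /negbTE ji; rewrite mxE ji.
rewrite [X in _ + _ * X](eq_bigr (fun j => b 0 j - a 0 j)); last first.
  by move=> j /negbTE ji; rewrite mxE ji.
by rewrite -mulrDl; have -> : t - a 0 i + (b 0 i - t) = b 0 i - a 0 i by ring.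
Qed.

Lemma measurable_coord (i : 'I_n) :
  measurable_fun setT
    (fun x : caratheodory_type (lebesgue_outer R n) => (x : 'rV[R]_n) 0 i).
Proof.
apply: (measurability _ (RGenOInfty.measurableE R)) => _ [_ [t ->] <-].
rewrite setTI; have := measurableC (halfspace_measurable i t).
congr measurable; apply/seteqP; split => x /=.
  by move/negP; rewrite -ltNge in_itv/= andbT.
by rewrite in_itv/= andbT ltNge => /negP.
Qed.

Lemma ball_rat_measurable d (X : measurableType d) (p : X -> 'rV[R]_n)
    (q : 'rV[rat]_n) (r : rat) :
  (forall i, measurable_fun setT (fun x => p x 0 i)) ->
  measurable [set x | forall i, ball (ratr (q 0 i) : R) (ratr r) (p x 0 i)].
Proof.
move=> mp.
rewrite (_ : [set _ | _] = \bigcap_(i in [set: 'I_n])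
    ((fun x => p x 0 i) @^-1` ball (ratr (q 0 i) : R) (ratr r))); last first.
  by apply/seteqP; split => x /= h i => [_|]; apply: h.
apply: fin_bigcap_measurable => // i _.
rewrite -[X in measurable X]setTI; apply: mp => //; exact: measurable_ball.
Qed.

(** An open set is the union of the rational cubes inside it; the other cubes contribute the empty
    set, so that the union runs over a whole countable type. The map [p] lets the result serve both
    the identity and the boundary charts. *)
Lemma preimage_open_measurable d (X : measurableType d) (p : X -> 'rV[R]_n)
    (O : set 'rV[R]_n) : open O ->
  (forall i, measurable_fun setT (fun x => p x 0 i)) ->
  measurable (p @^-1` O).
Proof.
move=> oO mp.
pose B (qr : 'rV[rat]_n * rat) : set 'rV[R]_n :=
  [set y | forall i, ball (ratr (qr.1 0 i) : R) (ratr qr.2) (y 0 i)].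
pose I := [set qr | B qr `<=` O].
rewrite (_ : p @^-1` O =
    \bigcup_qr (if `[< I qr >] then p @^-1` B qr else set0)); last first.
  apply/seteqP; split => x /=; last first.
    by case=> qr _; case: asboolP => // h; exact: h.
  move=> Opx; have /nbhs_ballP[e /= e0 eO] := open_nbhs_nbhs (conj oO Opx).
  (* With [r < e / 2], a rational centre within [r] of [p x] gives a cube of radius [r] that
     contains [p x] and stays within [e] of it. *)
  have [r re] : exists r : rat, ratr r \in `]0, (e / 2)[%R.
    by apply: rat_in_itvoo; rewrite divr_gt0.
  move: re; rewrite in_itv/= => /andP[r0 re].
  have Hq (i : 'I_n) : {q : rat | ratr q \in `](p x 0 i - ratr r), (p x 0 i + ratr r)[%R}.
    apply/cid; have /rat_in_itvoo // : p x 0 i - ratr r < p x 0 i + ratr r.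
    by rewrite ltrD2l; apply: lt_trans (r0); rewrite oppr_lt0.
  pose q : 'rV[rat]_n := \row_i sval (Hq i).
  have Hq' i : p x 0 i - ratr r < ratr (q 0 i) < p x 0 i + ratr r.
    by rewrite mxE; have := svalP (Hq i); rewrite in_itv.
  exists (q, r) => //; case: asboolP => [_ i|].
    by rewrite /ball /= ltr_distl; move: (Hq' i); set a := ratr _ => /andP[? ?]; apply/andP; split; lra.
  case=> y /= By; apply: eO; split => // i j.
  rewrite (ord1 i); have := By j; rewrite /ball /= !ltr_distl.
  have := Hq' j; set a := ratr (q 0 j) => /andP[? ?] /andP[? ?].
  by apply/andP; split; lra.
apply: countable_bigcupT_measurable => // qr; case: asboolP => // _.
exact: ball_rat_measurable.
Qed.

Lemma continuous_comp_measurable d (X : measurableType d) (p : X -> 'rV[R]_n)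
    (f : 'rV[R]_n -> R) : continuous f ->
  (forall i, measurable_fun setT (fun x => p x 0 i)) ->
  measurable_fun setT (fun x => f (p x)).
Proof.
move=> cf mp; apply: (measurability _ (RGenOpens.measurableE R)).
move=> _ [_ [a [b ->] <-]]; rewrite setTI.
apply: (@preimage_open_measurable _ _ p (f @^-1` `]a, b[)) => //.
by move/continuousP: cf; apply; exact: interval_open.
Qed.

Lemma open_lebesgue_measurable (O : set 'rV[R]_n) : open O ->
  measurable (O : set (caratheodory_type (lebesgue_outer R n))).
Proof.
move=> oO.
exact: (@preimage_open_measurable _ (caratheodory_type (lebesgue_outer R n)) id
  O oO measurable_coord).
Qed.

Lemma continuous_lebesgue_measurable (f : 'rV[R]_n -> R) : continuous f ->
  measurable_fun setT (f : caratheodory_type (lebesgue_outer R n) -> R).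
Proof.
move=> cf.
exact: (@continuous_comp_measurable _ (caratheodory_type (lebesgue_outer R n)) id
  f cf measurable_coord).
Qed.

Definition cube (r : R) : set 'rV[R]_n := closed_box (const_mx (- r)) (const_mx r).

Lemma cube_measurable (r : R) :
  measurable (cube r : set (caratheodory_type (lebesgue_outer R n))).
Proof.
rewrite (_ : cube r = \bigcap_(i in [set: 'I_n])
    ((fun x : 'rV[R]_n => x 0 i) @^-1` `[- r, r])); last first.
  apply/seteqP; split => x /= h i.
    by move=> _ /=; have := h i; rewrite !mxE in_itv.
  by have := h i Logic.I; rewrite /= !mxE in_itv.
apply: fin_bigcap_measurable => // i _.
by rewrite -[X in measurable X]setTI; exact: measurable_coord.
Qed.

Lemma cube_lty (r : R) : 0 <= r -> (leb (cube r) < +oo)%E.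
Proof.
move=> r0; pose F k : set 'rV[R]_n := if k is 0%N then cube r else set0.
apply: (@le_lt_trans _ _ (\sum_(k <oo) box_volume (F k))%E).
  by apply: ereal_inf_lbound; exists F => //= x xr; exists 0%N.
rewrite nneseries_recl//; last by move=> k _; exact: box_volume_ge0.
rewrite eseries0 ?adde0; last by case=> // k _ _; exact: box_volume0.
rewrite (le_lt_trans (@closed_box_volume_le (const_mx (- r)) (const_mx r) _ _ _)) ?ltry//.
by move=> i; rewrite !mxE ge0_cp.
Qed.

Lemma lebesgue_rV_sigma_finite : sigma_finite setT leb.
Proof.
exists (fun k => cube k%:R); last first.
  by move=> k; split; [exact: cube_measurable|exact: cube_lty].
apply/seteqP; split => // x _.
(* The sum over all coordinates serves as a common bound in place of a maximum. *)
exists (\sum_(i < n) (Num.truncn `|(x : 'rV[R]_n) 0%R i|%R).+1)%N => //= i; rewrite !mxE -ler_norml.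
apply: le_trans (ltW (truncnS_gt _)) _; rewrite ler_nat (bigD1 i)//=.
exact: leq_addr.
Qed.

Lemma lebesgue_rV_complete : measure_is_complete leb.
Proof. exact: measure_is_complete_caratheodory. Qed.

End lebesgue_measurability.
Arguments cube {R} n r.

(** * Test functions and their square integrability *)

Section test_functions.
Context (R : realType) (n : nat).
Local Notation leb := (lebesgue_rV R n).
Implicit Types (D : set 'rV[R]_n) (f g phi : 'rV[R]_n -> R).

Lemma compact_support_L2 f (K : set 'rV[R]_n) : continuous f -> compact K ->
  (forall x, ~ K x -> f x = 0) -> L2 leb setT (fun x => (f x)%:C%C).
Proof.
move=> cf cK f0.
have mf : measurable_fun setT (f : caratheodory_type (lebesgue_outer R n) -> R).
  exact: continuous_lebesgue_measurable.
have [C C0 fC] : exists2 C, 0 <= C & forall x, `|f x| <= C.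
  (* Every number beyond [M] is a bound, whence [M + 1]; the maximum with 0 below covers an empty
     [K]. *)
  have [M [_ /(_ (M + 1))]] : bounded_set (f @` K).
    apply/compact_bounded/continuous_compact => //.
    exact: continuous_subspaceT.
  rewrite ltrDl ltr01 => /(_ isT) fM.
  exists (Num.max 0 (M + 1)); first by rewrite le_max lexx.
  move=> x; have [Kx|/f0 ->] := pselect (K x); last by rewrite normr0 le_max lexx.
  by rewrite le_max fM ?orbT//; exists x.
have [r r0 Kr] : exists2 r : R, 0 <= r & K `<=` cube n r.
  have [M [_ /(_ (M + 1))]] := compact_bounded cK.
  rewrite ltrDl ltr01 => /(_ isT) KM; exists (Num.max 0 (M + 1)).
    by rewrite le_max lexx.
  move=> x /KM /= xM i; rewrite !mxE -ler_norml; apply: le_trans (_ : `|x| <= _).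
    rewrite [leRHS]mx_normrE.
    exact: (le_bigmax _ (fun ij : 'I_1 * 'I_n => `|x ij.1 ij.2|) (0, i)).
  by rewrite le_max xM orbT.
split=> //; rewrite /L2sqnorm.
have -> : (\int[leb]_x (sqnormc (f x)%:C%C)%:E = \int[leb]_(x in cube n r) (f x ^+ 2)%:E)%E.
  rewrite [RHS]integral_mkcond; apply: eq_integral => x _.
  rewrite patchE /sqnormc /= expr0n addr0; have [//|/negP xr] := boolP (x \in cube n r).
  by rewrite f0 ?expr0n// => /Kr /mem_set.
apply: (@le_lt_trans _ _ (\int[leb]_(x in cube n r) (C ^+ 2)%:E)%E).
  apply: ge0_le_integral; first exact: cube_measurable.
  - by move=> x _; rewrite lee_fin sqr_ge0.
  - by apply/measurable_EFinP/measurable_funX; exact: measurable_funTS.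
  - exact: measurable_cst.
  - by move=> x _; rewrite lee_fin -real_normK ?num_real// lerXn2r ?nnegrE.
rewrite integral_cst; last exact: cube_measurable.
by rewrite lte_mul_pinfty ?lee_fin ?sqr_ge0//; exact: cube_lty.
Qed.

Lemma rV_compact_closed (K : set 'rV[R]_n) : compact K -> closed K.
Proof. by apply: compact_closed; exact: (@norm_hausdorff R 'rV[R]_n). Qed.

(** The complement of [K] is open, so near a point outside [K] the difference quotient is constantly
    0. *)
Lemma partial_eq0 i f (K : set 'rV[R]_n) : closed K ->
  (forall x, ~ K x -> f x = 0) -> forall x, ~ K x -> partial i f x = 0.
Proof.
move=> cK f0 x Kx; rewrite /partial /derive; apply: cvg_lim => //.
apply: cvg_near_cst; near=> h => /=.
rewrite (f0 x Kx) subr0 f0 ?scaler0//.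
near: h; apply: nbhs_dnbhs.
have nK : nbhs x (~` K).
  by apply: open_nbhs_nbhs; split => //; exact: closed_openC.
have cs : (fun h : R => h *: (delta_mx 0 i : 'rV[R]_n) + x) @ 0 --> x.
  rewrite -[X in _ --> X]add0r; apply: cvgD; last exact: cvg_cst.
  rewrite -[X in _ --> X](scale0r (delta_mx 0 i)).
  by apply: cvgZr_tmp; exact: cvg_id.
exact: (cs _ nK).
Unshelve. all: by end_near. Qed.

Lemma test_fun_partial D i phi : test_fun D phi -> test_fun D (partial i phi).
Proof.
case=> Cphi [K [cK KD phi0]]; split.
  by move=> k; have [_ /(_ i)[]] := Cphi k.+1.
exists K; split=> //; by apply: partial_eq0 => //; exact: rV_compact_closed.
Qed.

Lemma test_fun_continuous D phi : test_fun D phi -> continuous phi.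
Proof. by case=> /(_ 0%N)[]. Qed.

Lemma test_fun_L2 D E phi : measurable (E : set (caratheodory_type (lebesgue_outer R n))) ->
  test_fun D phi -> L2 leb E (fun x => (phi x)%:C%C).
Proof.
move=> mE tphi; apply: (L2S measurableT mE (@subsetT _ _)).
have [_ [K [cK _ phi0]]] := tphi.
exact: compact_support_L2 (test_fun_continuous tphi) cK phi0.
Qed.

Definition laplacian phi : 'rV[R]_n -> R := fun x => \sum_i partial i (partial i phi) x.

Lemma laplacian_L2 D E phi : measurable (E : set (caratheodory_type (lebesgue_outer R n))) ->
  test_fun D phi -> L2 leb E (fun x => (laplacian phi x)%:C%C).
Proof.
move=> mE tphi; have [_ [K [cK _ phi0]]] := tphi.
apply: (L2S measurableT mE (@subsetT _ _)); apply: (compact_support_L2 _ cK).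
  apply: (continuous_big add_continuous) => i _.
  exact: (test_fun_continuous (test_fun_partial i (test_fun_partial i tphi))).
have cK' := rV_compact_closed cK.
move=> x Kx; rewrite /laplacian big1// => i _.
exact: (partial_eq0 _ cK' (partial_eq0 _ cK' phi0) Kx).
Qed.

Lemma test_funS D E phi : D `<=` E -> test_fun D phi -> test_fun E phi.
Proof.
move=> DE [Cphi [K [cK KD phi0]]]; split => //.
by exists K; split => //; exact: subset_trans DE.
Qed.

Lemma ctest_fun_L2 D (f : 'rV[R]_n -> R[i]) : ctest_fun D f -> L2 leb setT f.
Proof.
move=> [fr fi].
rewrite (_ : f = fun x => (complex.Re (f x))%:C%C + 'i%C * (complex.Im (f x))%:C%C).
  exact: (L2D measurableT (test_fun_L2 measurableT fr)
    (L2Z _ measurableT (test_fun_L2 measurableT fi))).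
apply/funext => x; case: (f x) => a b /=.
by apply: complex_eqP; rewrite raddfD /= ?Re_mulc ?Im_mulc /=; ring.
Qed.

End test_functions.

(** * The Gagliardo seminorm of a difference *)

Section gagliardo.
Context (R : realType) (n : nat).
Local Notation leb := (lebesgue_rV R n).
Local Notation T := (caratheodory_type (lebesgue_outer R n)).
Implicit Types (u v : 'rV[R]_n -> R[i]).

Let k (p : R) u (xy : T * T) : \bar R :=
  (sqnormc (u xy.1 - u xy.2) / enorm ((xy.1 : 'rV[R]_n) - xy.2) `^ p)%:E.

Let k_ge0 p u xy : (0 <= k p u xy)%E.
Proof. by rewrite lee_fin divr_ge0 ?sqnormc_ge0// powR_ge0. Qed.

Lemma measurable_enormB :
  measurable_fun setT (fun xy : T * T => enorm ((xy.1 : 'rV[R]_n) - xy.2)).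
Proof.
apply: (@measurableT_comp _ _ _ _ _ _ (@Num.sqrt R)).
  by apply: continuous_measurable_fun; exact: sqrt_continuous.
apply: measurable_sum => i; apply: measurable_funX.
under eq_fun do rewrite !mxE.
apply: measurable_funB.
  exact: (measurableT_comp (measurable_coord i) measurable_fst).
exact: (measurableT_comp (measurable_coord i) measurable_snd).
Qed.

Let measurable_k p u :
  measurable_fun setT (fun x : T => complex.Re (u x)) ->
  measurable_fun setT (fun x : T => complex.Im (u x)) ->
  measurable_fun setT (k p u).
Proof.
move=> ur ui; apply/measurable_EFinP; apply: measurable_funM.
  apply: measurable_sqnormc.
    apply: measurable_ReB.
      exact: (measurableT_comp ur measurable_fst).
    exact: (measurableT_comp ur measurable_snd).
  apply: measurable_ImB.
    exact: (measurableT_comp ui measurable_fst).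
  exact: (measurableT_comp ui measurable_snd).
under eq_fun do rewrite -powRN.
exact: (measurableT_comp (measurable_powR (- p)) measurable_enormB).
Qed.

(** Tonelli's theorem, which is where sigma-finiteness of Lebesgue measure enters. *)
Let measurable_int_k p u :
  measurable_fun setT (fun x : T => complex.Re (u x)) ->
  measurable_fun setT (fun x : T => complex.Im (u x)) ->
  measurable_fun setT (fun x : T => \int[leb]_y k p u (x, y))%E.
Proof.
move=> ur ui.
pose sf : {sigma_finite_measure set T -> \bar R} := HB.pack (leb : set T -> \bar R)
  (Measure.class leb)
  (Measure_isSigmaFinite.Build _ _ _ (leb : set T -> \bar R) (lebesgue_rV_sigma_finite R n)).
exact: (measurable_fun_fubini_tonelli_F (m2 := sf) (k p u) (measurable_k p ur ui) (k_ge0 p u)).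
Qed.

Lemma gagliardo_sqnorm_ge0 sigma u : (0 <= gagliardo_sqnorm sigma u)%E.
Proof.
rewrite /gagliardo_sqnorm; case: ifP => // _.
by apply: integral_ge0 => x _; apply: integral_ge0 => y _; exact: (k_ge0 _ _ (x, y)).
Qed.

(** The pointwise inequality is integrated in [y] for fixed [x], and the result in [x]; each pass
    needs measurability of its own integrand. *)
Lemma gagliardo_sqnormB_le sigma u v :
  measurable_fun setT (fun x : T => complex.Re (u x)) ->
  measurable_fun setT (fun x : T => complex.Im (u x)) ->
  measurable_fun setT (fun x : T => complex.Re (v x)) ->
  measurable_fun setT (fun x : T => complex.Im (v x)) ->
  (gagliardo_sqnorm sigma (fun x => (u x - v x)%R)
     <= 2%:E * (gagliardo_sqnorm sigma u + gagliardo_sqnorm sigma v))%E.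
Proof.
move=> ur ui vr vi; rewrite /gagliardo_sqnorm; case: (sigma == 0).
  by rewrite adde0 mule0.
set p := (_ + _)%R.
have sub w (mw : measurable_fun setT (k p w)) x :
    measurable_fun setT (fun y => k p w (x, y)).
  exact: (@measurable_fun_pair2 _ _ _ _ _ _ (k p w) x mw).
have I_ge0 w x : (0 <= \int[leb]_y k p w (x, y))%E by exact: integral_ge0.
have wr := measurable_ReB ur vr; have wi := measurable_ImB ui vi.
apply: (@ge0_integral_le2D _ _ _ leb setT (fun x => \int[leb]_y k p u (x, y))%E
  (fun x => \int[leb]_y k p v (x, y))%E
  (fun x => \int[leb]_y k p (fun x => (u x - v x)%R) (x, y))%E measurableT
  (I_ge0 u) (I_ge0 v) (I_ge0 _) (measurable_int_k p ur ui)
  (measurable_int_k p vr vi) (measurable_int_k p wr wi)) => x.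
apply: (@ge0_integral_le2D _ _ _ leb setT (fun y => k p u (x, y))
  (fun y => k p v (x, y)) (fun y => k p (fun x => (u x - v x)%R) (x, y))
  measurableT (fun y => k_ge0 p u (x, y)) (fun y => k_ge0 p v (x, y))
  (fun y => k_ge0 p _ (x, y)) (sub _ (measurable_k p ur ui) x)
  (sub _ (measurable_k p vr vi) x) (sub _ (measurable_k p wr wi) x)) => y.
rewrite -EFinD -EFinM lee_fin -mulrDl mulrA ler_wpM2r//.
  by rewrite invr_ge0 powR_ge0.
exact: sqnormc_subACA_le.
Qed.

End gagliardo.

(** * The factor-2 inequality under infima, sums and limits *)

Section extended_reals.
Context (R : realType).
Local Open Scope ereal_scope.

(** Elements within [e / 4] of the infima cost [2 * (e / 4 + e / 4) = e]. They exist only for finite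
    infima; an infinite one makes the right-hand side infinite. *)
Lemma lee_inf2D (A B : set (\bar R)) (x : \bar R) :
  (forall a, A a -> 0 <= a) -> (forall b, B b -> 0 <= b) ->
  (forall a b, A a -> B b -> x <= 2%:E * (a + b)) ->
  x <= 2%:E * (ereal_inf A + ereal_inf B).
Proof.
move=> A0 B0 xAB.
have IA0 : 0 <= ereal_inf A by apply: le_ereal_inf_tmp.
have IB0 : 0 <= ereal_inf B by apply: le_ereal_inf_tmp.
have [->|IA] := eqVneq (ereal_inf A) +oo.
  by rewrite addye ?gt0_muley ?leey ?lte_fin// gt_eqF// (lt_le_trans _ IB0)// ltNyr.
have [->|IB] := eqVneq (ereal_inf B) +oo.
  by rewrite addey ?gt0_muley ?leey ?lte_fin// gt_eqF// (lt_le_trans _ IA0)// ltNyr.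
have fA : ereal_inf A \is a fin_num by rewrite ge0_fin_numE// lt_neqAle IA leey.
have fB : ereal_inf B \is a fin_num by rewrite ge0_fin_numE// lt_neqAle IB leey.
apply/lee_addgt0Pr => e e0.
have e4 : (0 < e / 4)%R by rewrite divr_gt0.
have [a Aa aIA] := lb_ereal_inf_adherent e4 fA.
have [b Bb bIB] := lb_ereal_inf_adherent e4 fB.
apply: le_trans (xAB _ _ Aa Bb) _.
apply: (@le_trans _ _ (2%:E * ((ereal_inf A + (e / 4)%:E) + (ereal_inf B + (e / 4)%:E)))).
  by rewrite lee_pmul2l ?lte_fin//; apply: leeD; exact: ltW.
case: (ereal_inf A) fA => // a' _; case: (ereal_inf B) fB => // b' _.
by rewrite lee_fin le_eqVlt; apply/orP; left; apply/eqP; field.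
Qed.

Lemma sum2D_le (I : finType) (f g h : I -> \bar R) :
  (forall i, 0 <= f i) -> (forall i, 0 <= g i) ->
  (forall i, h i <= 2%:E * (f i + g i)) ->
  \sum_i h i <= 2%:E * (\sum_i f i + \sum_i g i).
Proof.
move=> f0 g0 hfg; rewrite -big_split/= ge0_sume_distrr; last first.
  by move=> i _; exact: adde_ge0.
exact: lee_sum.
Qed.

Lemma add2D_le (a b c d x y : \bar R) :
  0 <= a -> 0 <= b -> 0 <= c -> 0 <= d ->
  x <= 2%:E * (a + b) -> y <= 2%:E * (c + d) ->
  x + y <= 2%:E * ((a + c) + (b + d)).
Proof.
move=> a0 b0 c0 d0 xab ycd; rewrite addeACA ge0_muleDr ?adde_ge0//.
exact: leeD.
Qed.

Lemma cvge0_2D (f g h : nat -> \bar R) :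
  (forall k, 0 <= h k) -> (forall k, h k <= 2%:E * (f k + g k)) ->
  f @ \oo --> 0 -> g @ \oo --> 0 -> h @ \oo --> 0.
Proof.
move=> h0 hfg f0 g0.
apply: (@squeeze_cvge _ _ _ _ (fun=> 0) _ (fun k => 2%:E * (f k + g k))).
- by near=> k; rewrite h0 hfg.
- exact: cvg_cst.
- rewrite -[X in _ --> X](mule0 2%:E); apply: cvgeZl => //.
  by rewrite -[X in _ --> X]adde0; exact: cvgeD.
Unshelve. all: by end_near. Qed.

Lemma cvge0_le (f h : nat -> \bar R) :
  (forall k, 0 <= h k) -> (forall k, h k <= f k) ->
  f @ \oo --> 0 -> h @ \oo --> 0.
Proof.
move=> h0 hf f0; apply: (@squeeze_cvge _ _ _ _ (fun=> 0) _ f) => //.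
- by near=> k; rewrite h0 hf.
- exact: cvg_cst.
Unshelve. all: by end_near. Qed.

End extended_reals.

(** * Weak derivatives under subtraction, conjugation and restriction *)

Section weak_derivatives.
Context (R : realType) (n : nat).
Local Notation leb := (lebesgue_rV R n).
Local Notation T := (caratheodory_type (lebesgue_outer R n)).
Implicit Types (D : set 'rV[R]_n) (u v w g h : 'rV[R]_n -> R[i]).
Implicit Types (r : 'rV[R]_n -> R).

Lemma cintegral_mulBl D u v w : measurable (D : set T) ->
  L2 leb D u -> L2 leb D v -> L2 leb D w ->
  cintegral leb D (fun x => (u x - v x) * w x) =
  cintegral leb D (fun x => u x * w x) - cintegral leb D (fun x => v x * w x).
Proof.
move=> mD Lu Lv Lw.
rewrite -(cintegralB mD (L2_cintegrableM mD Lu Lw) (L2_cintegrableM mD Lv Lw)).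
by congr cintegral; apply/funext => x; rewrite mulrBl.
Qed.

Lemma cintegral_mul_conj D u r : measurable (D : set T) ->
  L2 leb D u -> L2 leb D (fun x => (r x)%:C%C) ->
  cintegral leb D (fun x => (u x)^*%C * (r x)%:C%C) =
  ((cintegral leb D (fun x => u x * (r x)%:C%C))^*)%C.
Proof.
move=> mD Lu Lw; rewrite -(cintegral_conj mD (L2_cintegrableM mD Lu Lw)).
by congr cintegral; apply/funext => x; rewrite rmorphM/= oppr0.
Qed.

Lemma weak_partialB D i u v g h : measurable (D : set T) ->
  L2 leb D u -> L2 leb D v -> L2 leb D g -> L2 leb D h ->
  weak_partial D i u g -> weak_partial D i v h ->
  weak_partial D i (fun x => u x - v x) (fun x => g x - h x).
Proof.
move=> mD Lu Lv Lg Lh ug vh phi tphi.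
have L1 := test_fun_L2 mD tphi.
have L1' := test_fun_L2 mD (test_fun_partial i tphi).
by rewrite !cintegral_mulBl// ug// vh// -opprD.
Qed.

Lemma weak_partial_conj D i u g : measurable (D : set T) ->
  L2 leb D u -> L2 leb D g -> weak_partial D i u g ->
  weak_partial D i (fun x => (u x)^*%C) (fun x => (g x)^*%C).
Proof.
move=> mD Lu Lg ug phi tphi.
have L1 := test_fun_L2 mD tphi.
have L1' := test_fun_L2 mD (test_fun_partial i tphi).
by rewrite !cintegral_mul_conj// ug// rmorphN.
Qed.

Lemma weak_laplacianB D u v g h : measurable (D : set T) ->
  L2 leb D u -> L2 leb D v -> L2 leb D g -> L2 leb D h ->
  weak_laplacian D u g -> weak_laplacian D v h ->
  weak_laplacian D (fun x => u x - v x) (fun x => g x - h x).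
Proof.
move=> mD Lu Lv Lg Lh ug vh phi tphi.
have L1 := test_fun_L2 mD tphi; have L1' := laplacian_L2 mD tphi.
by rewrite !cintegral_mulBl// ug// vh.
Qed.

Lemma weak_laplacian_conj D u g : measurable (D : set T) ->
  L2 leb D u -> L2 leb D g -> weak_laplacian D u g ->
  weak_laplacian D (fun x => (u x)^*%C) (fun x => (g x)^*%C).
Proof.
move=> mD Lu Lg ug phi tphi.
have L1 := test_fun_L2 mD tphi; have L1' := laplacian_L2 mD tphi.
by rewrite !cintegral_mul_conj// ug.
Qed.

Lemma weak_gradientB D u v G H : measurable (D : set T) ->
  L2 leb D u -> L2 leb D v -> weak_gradient D u G -> weak_gradient D v H ->
  weak_gradient D (fun x => u x - v x) (fun i x => G i x - H i x).
Proof.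
move=> mD Lu Lv uG vH i; have [LG uGi] := uG i; have [LH vHi] := vH i.
by split; [exact: L2B|exact: weak_partialB].
Qed.

Lemma weak_gradient_conj D u G : measurable (D : set T) ->
  L2 leb D u -> weak_gradient D u G ->
  weak_gradient D (fun x => (u x)^*%C) (fun i x => (G i x)^*%C).
Proof.
move=> mD Lu uG i; have [LG uGi] := uG i.
by split; [exact: L2_conj|exact: weak_partial_conj].
Qed.

(** A test function on [D] and its partial derivatives vanish off [D], so their integrals over the
    whole space are integrals over [D], where [u] may replace [v]. *)
Lemma weak_gradient_restrict D u v G : open D -> L2 leb setT v ->
  ae_eq leb D u v -> weak_gradient setT v G -> weak_gradient D u G.
Proof.
move=> oD Lv uv vG i; have [LG vGi] := vG i.
have mD : measurable (D : set T) by exact: open_lebesgue_measurable.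
have LvD : L2 leb D v := L2S measurableT mD (@subsetT _ D) Lv.
have vu : ae_eq leb D v u by move: uv; apply: filterS => x + Dx => ->.
have LuD := L2_ae_eq (@lebesgue_rV_complete R n) mD vu LvD.
split; first exact: L2S measurableT mD (@subsetT _ D) LG.
move=> phi tphi; have := vGi _ (test_funS (@subsetT _ D) tphi).
have tphi' := test_fun_partial i tphi.
have off (psi : 'rV[R]_n -> R) x : test_fun D psi -> ~ D x -> psi x = 0.
  by move=> [_ [K [_ KD psi0]]] Dx; apply: psi0 => /KD.
have restr (psi : 'rV[R]_n -> R) f : test_fun D psi ->
    cintegral leb setT (fun x => f x * (psi x)%:C%C) =
    cintegral leb D (fun x => f x * (psi x)%:C%C).
  move=> tpsi; apply/esym/cintegral_mkcond => // x Dx.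
  by rewrite (off _ _ tpsi Dx) mulr0.
rewrite !restr// => <-; apply: (ae_eq_cintegral mD).
- exact: (L2_cintegrableM mD LuD (test_fun_L2 mD tphi')).
- exact: (L2_cintegrableM mD LvD (test_fun_L2 mD tphi')).
- by move: uv; apply: filterS => x + Dx => /(_ Dx) ->.
Qed.

End weak_derivatives.

(** * Sobolev norms and spaces *)

Section sobolev_norms.
Context (R : realType) (n : nat).
Local Notation leb := (lebesgue_rV R n).
Local Notation T := (caratheodory_type (lebesgue_outer R n)).
Implicit Types (D : set 'rV[R]_n) (u v w : 'rV[R]_n -> R[i]).

Lemma sobolev_sqnorm_rec_ge0 k (sigma : R) u : (0 <= sobolev_sqnorm_rec k sigma u)%E.
Proof.
elim: k u => [|k IH] u /=; rewrite adde_ge0 ?L2sqnorm_ge0 ?gagliardo_sqnorm_ge0//.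
by apply: le_ereal_inf_tmp => _ [G _ <-]; exact: sume_ge0.
Qed.

(** Order below 1, under measurability alone: it will be applied to boundary pieces of smooth
    functions, whose square integrability is not established. *)
Lemma sobolev_sqnorm_rec0B_le (sigma : R) u v :
  measurable_fun setT (fun x : T => complex.Re (u x)) ->
  measurable_fun setT (fun x : T => complex.Im (u x)) ->
  measurable_fun setT (fun x : T => complex.Re (v x)) ->
  measurable_fun setT (fun x : T => complex.Im (v x)) ->
  (sobolev_sqnorm_rec 0 sigma (fun x => (u x - v x)%R) <=
   2%:E * (sobolev_sqnorm_rec 0 sigma u + sobolev_sqnorm_rec 0 sigma v))%E.
Proof.
move=> ur ui vr vi /=; apply: add2D_le;
  rewrite ?L2sqnorm_ge0 ?gagliardo_sqnorm_ge0//.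
  exact: (L2sqnormB_le _ measurableT ur ui vr vi).
exact: gagliardo_sqnormB_le.
Qed.

(** The difference of weak gradients of [u] and [v] is one of [u - v], hence competes in the infimum
    for [u - v]; its components are handled by the induction on the order. *)
Lemma sobolev_sqnorm_recB_le k (sigma : R) u v :
  L2 leb setT u -> L2 leb setT v ->
  (sobolev_sqnorm_rec k sigma (fun x => (u x - v x)%R) <=
   2%:E * (sobolev_sqnorm_rec k sigma u + sobolev_sqnorm_rec k sigma v))%E.
Proof.
elim: k u v => [|k IH] u v Lu Lv.
  by case: Lu Lv => [ur ui _] [vr vi _]; exact: sobolev_sqnorm_rec0B_le.
have inf_ge0 w : (0 <= ereal_inf [set \sum_(i < n) sobolev_sqnorm_rec k sigma (G i) |
    G in [set G | weak_gradient setT w G]])%E.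
  apply: le_ereal_inf_tmp => _ [G _ <-]; apply: sume_ge0 => i _.
  exact: sobolev_sqnorm_rec_ge0.
rewrite /=; apply: add2D_le; rewrite ?L2sqnorm_ge0//.
  case: Lu Lv => [ur ui _] [vr vi _].
  exact: (L2sqnormB_le _ measurableT ur ui vr vi).
apply: lee_inf2D.
- move=> _ [G _ <-]; apply: sume_ge0 => i _; exact: sobolev_sqnorm_rec_ge0.
- move=> _ [G _ <-]; apply: sume_ge0 => i _; exact: sobolev_sqnorm_rec_ge0.
move=> _ _ [G uG <-] [H vH <-].
apply: (@le_trans _ _ (\sum_(i < n) sobolev_sqnorm_rec k sigma (fun x => G i x - H i x)%R)%E).
  apply: ereal_inf_lbound; exists (fun i x => G i x - H i x); last by [].
  exact: (weak_gradientB measurableT Lu Lv uG vH).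
apply: sum2D_le => i; [exact: sobolev_sqnorm_rec_ge0|exact: sobolev_sqnorm_rec_ge0|].
by apply: IH; [case: (uG i)|case: (vH i)].
Qed.

Lemma gagliardo_sqnorm_conj (sigma : R) u :
  gagliardo_sqnorm sigma (fun x => (u x)^*%C) = gagliardo_sqnorm sigma u.
Proof.
rewrite /gagliardo_sqnorm; case: (sigma == 0); first by [].
by under eq_integral => x _ do under eq_integral => y _ do rewrite -rmorphB sqnormc_conj.
Qed.

(** The conjugate of a weak gradient of [u] competes in the infimum for the conjugate of [u]. One
    inequality is enough for membership and for limits equal to 0. *)
Lemma sobolev_sqnorm_rec_conj_le k (sigma : R) u : L2 leb setT u ->
  (sobolev_sqnorm_rec k sigma (fun x => (u x)^*%C) <= sobolev_sqnorm_rec k sigma u)%E.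
Proof.
elim: k u => [|k IH] u Lu /=; rewrite L2sqnorm_conj.
  by rewrite gagliardo_sqnorm_conj.
apply: leeD2l; apply: le_ereal_inf_tmp => _ [G uG <-].
apply: (@le_trans _ _ (\sum_(i < n) sobolev_sqnorm_rec k sigma (fun x => (G i x)^*%C))%E).
  apply: ereal_inf_lbound; exists (fun i x => (G i x)^*%C); last by [].
  exact: (weak_gradient_conj measurableT Lu uG).
by apply: lee_sum => i _; apply: IH; case: (uG i).
Qed.

Lemma sobolevB (s : R) u v : sobolev s u -> sobolev s v ->
  sobolev s (fun x => u x - v x).
Proof.
move=> [Lu uoo] [Lv voo]; split; first exact: (L2B measurableT).
apply: le_lt_trans (sobolev_sqnorm_recB_le _ _ Lu Lv) _.
by rewrite lte_mul_pinfty ?lee_fin// lte_add_pinfty.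
Qed.

Lemma sobolev_conj (s : R) u : sobolev s u -> sobolev s (fun x => (u x)^*%C).
Proof.
move=> [Lu uoo]; split; first exact: L2_conj.
exact: le_lt_trans (sobolev_sqnorm_rec_conj_le _ _ Lu) uoo.
Qed.

Lemma sobolev_onB (s : R) D u v : sobolev_on s D u -> sobolev_on s D v ->
  sobolev_on s D (fun x => u x - v x).
Proof.
move=> [U sU uU] [V sV vV]; exists (fun x => U x - V x); first exact: sobolevB.
by move: uU vV; apply: filterS2 => x + + Dx => /(_ Dx) -> /(_ Dx) ->.
Qed.

Lemma sobolev_on_conj (s : R) D u : sobolev_on s D u ->
  sobolev_on s D (fun x => (u x)^*%C).
Proof.
move=> [U sU uU]; exists (fun x => (U x)^*%C); first exact: sobolev_conj.
by move: uU; apply: filterS => x + Dx => /(_ Dx) ->.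
Qed.

Lemma sobolev_on_L2 (s : R) D u : open D -> sobolev_on s D u -> L2 leb D u.
Proof.
move=> oD [U [LU _] uU].
have mD : measurable (D : set T) by exact: open_lebesgue_measurable.
apply: (L2_ae_eq (@lebesgue_rV_complete R n) mD _ (L2S measurableT mD (@subsetT _ D) LU)).
by move: uU; apply: filterS => x + Dx => ->.
Qed.

Lemma sobolev_sqnorm_lt1E (s : R) u : 0 <= s < 1 ->
  sobolev_sqnorm s u = sobolev_sqnorm_rec 0 s u.
Proof.
move=> /andP[s0 s1]; rewrite /sobolev_sqnorm.
have -> : Num.truncn s = 0%N by apply: truncn_def; rewrite s0.
by rewrite subr0.
Qed.

(** Without a weak gradient of the extension, the infimum in its norm would run over the empty set
    and be [+oo]. *)
Lemma sobolev_on_weak_gradient D u : open D -> sobolev_on 1 D u ->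
  exists G, weak_gradient D u G.
Proof.
move=> oD [U [LU +] uU]; rewrite /sobolev_sqnorm truncn1 /= => Uoo.
suff [G UG] : exists G, weak_gradient setT U G.
  by exists G; exact: weak_gradient_restrict UG.
apply: contrapT => noG; move: Uoo.
rewrite [X in ereal_inf X](_ : _ = set0); last first.
  by apply/seteqP; split => // ? [G UG _]; apply: noG; exists G.
by rewrite ereal_inf0 addey ?ltxx// gt_eqF// (lt_le_trans _ (L2sqnorm_ge0 _ _ _))// ltNyr.
Qed.

End sobolev_norms.

(** * Smooth and Lipschitz functions *)

Section smooth_functions.
Context (R : realType) (n : nat).
Implicit Types (D : set 'rV[R]_n) (f g : 'rV[R]_n -> R).

Lemma CkB k f g : Ck k f -> Ck k g -> Ck k (fun x => f x - g x).
Proof.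
elim: k f g => [|k IH] f g [cf df] [cg dg].
  by split => // x; exact: (continuousB (cf x) (cg x)).
split; first by move=> x; exact: (continuousB (cf x) (cg x)).
move=> i; have [dfi Cf] := df i; have [dgi Cg] := dg i; split.
  by move=> x; exact: derivableB.
rewrite (_ : partial i _ = fun x => partial i f x - partial i g x); first exact: IH.
by apply/funext => x; exact: deriveB.
Qed.

Lemma CkN k f : Ck k f -> Ck k (fun x => - f x).
Proof.
elim: k f => [|k IH] f [cf df].
  by split => // x; exact: (continuousN (cf x)).
split; first by move=> x; exact: (continuousN (cf x)).
move=> i; have [dfi Cf] := df i; split.
  by move=> x; exact: derivableN.
rewrite (_ : partial i _ = fun x => - partial i f x); first exact: IH.
by apply/funext => x; exact: deriveN.
Qed.

Lemma test_funB D f g : test_fun D f -> test_fun D g ->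
  test_fun D (fun x => f x - g x).
Proof.
move=> [Cf [K [cK KD f0]]] [Cg [L [cL LD g0]]]; split.
  by move=> k; exact: CkB.
exists (K `|` L); split; [exact: compactU|by rewrite subUset|].
by move=> x /not_orP[Kx Lx]; rewrite f0// g0// subrr.
Qed.

Lemma test_funN D f : test_fun D f -> test_fun D (fun x => - f x).
Proof.
move=> [Cf [K [cK KD f0]]]; split; first by move=> k; exact: CkN.
by exists K; split => // x Kx; rewrite f0// oppr0.
Qed.

Lemma ctest_funB D (f g : 'rV[R]_n -> R[i]) : ctest_fun D f -> ctest_fun D g ->
  ctest_fun D (fun x => f x - g x).
Proof.
move=> [fr fi] [gr gi]; split.
  by rewrite (funext (fun x => Re_subc (f x) (g x))); exact: test_funB.
by rewrite (funext (fun x => Im_subc (f x) (g x))); exact: test_funB.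
Qed.

Lemma ctest_fun_conj D (f : 'rV[R]_n -> R[i]) : ctest_fun D f ->
  ctest_fun D (fun x => (f x)^*%C).
Proof.
move=> [fr fi]; split.
  by under eq_fun do rewrite Re_conjc.
by under eq_fun do rewrite Im_conjc; exact: test_funN.
Qed.

(** The Lipschitz bound is Euclidean while the topology is that of the sup norm. The link is that
    [enorm (x - y)], the root of a polynomial in the coordinates, is continuous in [y] and vanishes
    at [x]. *)
Lemma enorm_lipschitz_continuous f (L : R) :
  (forall x y, `|f x - f y| <= L * enorm (x - y)) -> continuous f.
Proof.
move=> fL x; apply/(@cvgrPdist_lt _ _ _ (nbhs x) (nbhs_filter x)) => e e0.
pose S (y : 'rV[R]_n) := \sum_i (x 0 i - y 0 i) ^+ 2.
have cS : continuous S.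
  apply: (continuous_big add_continuous) => i _ v.
  exact: (continuous_comp (continuousB (@cst_continuous _ _ (x 0 i) v)
    (@coord_continuous _ _ _ 0 i v)) (@exprn_continuous _ 2 _)).
have SE y : enorm (x - y) = Num.sqrt (S y).
  by rewrite /enorm; congr Num.sqrt; apply: eq_bigr => i _; rewrite !mxE.
have cg : continuous (fun y : 'rV[R]_n => enorm (x - y)).
  rewrite (funext SE) => y.
  exact: (continuous_comp (cS y) (@sqrt_continuous _ _)).
(* [L] may be 0 or negative, whereas [|L| + 1] can be divided by. *)
have L0 : 0 < `|L| + 1 by rewrite ltr_wpDl.
have : (fun y => enorm (x - y)) @ x --> (0 : R).
  have := cg x; rewrite /continuous_at subrr /enorm big1 ?sqrtr0// => i _.
  by rewrite mxE expr0n.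
move=> /cvgr0Pnorm_lt /(_ (e / (`|L| + 1)) (divr_gt0 e0 L0)) near_e.
near=> y; apply: le_lt_trans (fL x y) _.
apply: (@le_lt_trans _ _ ((`|L| + 1) * `|enorm (x - y)|)).
  apply: le_trans (ler_norm _) _; rewrite normrM ler_wpM2r//.
  by rewrite lerDl.
by rewrite mulrC -ltr_pdivlMr//; near: y.
Unshelve. all: by end_near. Qed.

End smooth_functions.

(** * Dirichlet and Neumann traces *)

Section boundary.
Context (R : realType) (n : nat).
Variables (Omega : set 'rV[R]_n) (At : atlas R n).
Hypotheses (oOmega : open Omega) (AtOmega : boundary_atlas Omega At).
Local Notation leb := (lebesgue_rV R n).
Local Notation func := ('rV[R]_n -> R[i]).
Local Notation T' := (caratheodory_type (lebesgue_outer R n.-1)).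
Implicit Types (u v f g w : func) (z : R[i]).

Let mOmega : measurable (Omega : set (caratheodory_type (lebesgue_outer R n))).
Proof. exact: open_lebesgue_measurable. Qed.

Lemma measurable_chart_graph j (i : 'I_n) :
  measurable_fun setT (fun y : T' => chart_graph (@atlas_chart _ _ At j) y 0 i).
Proof.
have [[lip _] _ _ _] := AtOmega; have [_ _ [L fL] _] := lip j.
have mf := continuous_lebesgue_measurable (enorm_lipschitz_continuous fL).
rewrite /chart_graph /chart_pt.
under eq_fun do rewrite !mxE.
apply: measurable_funD; first exact: measurable_cst.
apply: measurable_sum => k; apply: measurable_funM; last exact: measurable_cst.
under eq_fun do rewrite mxE.
(* Either [k] is one of the first [n.-1] coordinates, or it is the last one, where [pair_rV] puts
   the height [chart_fun]. *)
case: (insub (val k)) => [l|] /=; last exact: mf.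
exact: measurable_coord.
Qed.

Lemma measurable_boundary_piece j f : ctest_fun setT f ->
  measurable_fun setT (fun y : T' => complex.Re (@boundary_piece _ _ At j f y)) /\
  measurable_fun setT (fun y : T' => complex.Im (@boundary_piece _ _ At j f y)).
Proof.
move=> [fr fi]; have [_ /(_ j) /test_fun_continuous cc _ _] := AtOmega.
have mc := continuous_comp_measurable cc (measurable_chart_graph j).
have mr := continuous_comp_measurable (test_fun_continuous fr) (measurable_chart_graph j).
have mi := continuous_comp_measurable (test_fun_continuous fi) (measurable_chart_graph j).
split.
  rewrite (_ : (fun _ => _) = fun y : T' =>
      @atlas_cutoff _ _ At j (chart_graph (atlas_chart j) y) *
      complex.Re (f (chart_graph (atlas_chart j) y))); first exact: measurable_funM.
  by apply/funext => y; rewrite /boundary_piece Re_mulc /= mul0r subr0.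
rewrite (_ : (fun _ => _) = fun y : T' =>
    @atlas_cutoff _ _ At j (chart_graph (atlas_chart j) y) *
    complex.Im (f (chart_graph (atlas_chart j) y))); first exact: measurable_funM.
by apply/funext => y; rewrite /boundary_piece Im_mulc /= mul0r addr0.
Qed.

Lemma boundary_pieceB j f g :
  @boundary_piece _ _ At j (fun x => f x - g x) =
  fun y => @boundary_piece _ _ At j f y - @boundary_piece _ _ At j g y.
Proof. by apply/funext => y; rewrite /boundary_piece mulrBr. Qed.

Lemma boundary_piece_conj j f :
  @boundary_piece _ _ At j (fun x => (f x)^*%C) =
  fun y => ((@boundary_piece _ _ At j f y)^*)%C.
Proof. by apply/funext => y; rewrite /boundary_piece rmorphM/= oppr0. Qed.

(** Square integrability of the difference on the boundary is taken as a hypothesis, so that the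
    frontier need not be shown measurable for the Hausdorff measure; in the application [f] is 0 and
    [L2N] supplies it. *)
Lemma sobolev_bdB (s : R) f g : L2_bd Omega (fun x => f x - g x) ->
  sobolev_bd Omega At s f -> sobolev_bd Omega At s g ->
  sobolev_bd Omega At s (fun x => f x - g x).
Proof.
move=> Lfg [_ sf] [_ sg]; split; first exact: Lfg.
by move=> j; rewrite boundary_pieceB; exact: sobolevB.
Qed.

Lemma sobolev_bd_conj (s : R) f : sobolev_bd Omega At s f ->
  sobolev_bd Omega At s (fun x => (f x)^*%C).
Proof.
move=> [Lf sf]; split; first exact: L2_conj.
by move=> j; rewrite boundary_piece_conj; exact: sobolev_conj.
Qed.

Lemma sobolev_bd_sqnorm_ge0 (s : R) f : (0 <= sobolev_bd_sqnorm At s f)%E.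
Proof. by apply: sume_ge0 => j _; exact: sobolev_sqnorm_rec_ge0. Qed.

Let half_itv : 0 <= (1 / 2 : R) < 1.
Proof. by apply/andP; split; lra. Qed.

(** The differences [p k - q k] of the approximating smooth functions approximate [U - V] in H^1 and
    [f - g] in H^(1/2) of the boundary. *)
Lemma dirichlet_traceB u v f g : L2_bd Omega (fun x => f x - g x) ->
  dirichlet_trace Omega At u f -> dirichlet_trace Omega At v g ->
  dirichlet_trace Omega At (fun x => u x - v x) (fun x => f x - g x).
Proof.
move=> Lfg [Hf [U [p [sU uU tp pU pf]]]] [Hg [V [q [sV vV tq qV qg]]]].
split; first exact: sobolev_bdB.
exists (fun x => U x - V x), (fun k x => p k x - q k x); split.
- exact: sobolevB.
- by move: uU vV; apply: filterS2 => x + + Dx => /(_ Dx) -> /(_ Dx) ->.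
- by move=> k; exact: ctest_funB.
- apply: cvge0_2D pU qV => k; first exact: sobolev_sqnorm_rec_ge0.
  rewrite (_ : (fun x => _ - _) =
    fun x => (p k x - U x) - (q k x - V x)); last by apply/funext => x; ring.
  apply: sobolev_sqnorm_recB_le; apply: (L2B measurableT).
  + exact: ctest_fun_L2 (tp k).
  + by case: sU.
  + exact: ctest_fun_L2 (tq k).
  + by case: sV.
- apply: cvge0_2D pf qg => k; first exact: sobolev_bd_sqnorm_ge0.
  rewrite (_ : (fun x => _ - _) =
    fun x => (p k x - f x) - (q k x - g x)); last by apply/funext => x; ring.
  apply: sum2D_le => j; [exact: sobolev_sqnorm_rec_ge0|exact: sobolev_sqnorm_rec_ge0|].
  (* As 1/2 < 1, only the base case of the norm occurs, for which measurability of the pieces is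
     enough. *)
  rewrite !(sobolev_sqnorm_lt1E _ half_itv) boundary_pieceB.
  have [pr pi] := measurable_boundary_piece j (tp k).
  have [qr qi] := measurable_boundary_piece j (tq k).
  have [_ /(_ j)[[fr fi _] _]] := Hf; have [_ /(_ j)[[gr gi _] _]] := Hg.
  apply: sobolev_sqnorm_rec0B_le; rewrite boundary_pieceB.
  + exact: measurable_ReB.
  + exact: measurable_ImB.
  + exact: measurable_ReB.
  + exact: measurable_ImB.
Qed.

Lemma dirichlet_trace_conj u f : dirichlet_trace Omega At u f ->
  dirichlet_trace Omega At (fun x => (u x)^*%C) (fun x => (f x)^*%C).
Proof.
move=> [Hf [U [p [sU uU tp pU pf]]]]; split; first exact: sobolev_bd_conj.
exists (fun x => (U x)^*%C), (fun k x => (p k x)^*%C); split.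
- exact: sobolev_conj.
- by move: uU; apply: filterS => x + Dx => /(_ Dx) ->.
- by move=> k; exact: ctest_fun_conj.
- apply: cvge0_le pU => k; first exact: sobolev_sqnorm_rec_ge0.
  under eq_fun do rewrite -rmorphB.
  apply: sobolev_sqnorm_rec_conj_le; apply: (L2B measurableT).
    exact: ctest_fun_L2 (tp k).
  by case: sU.
- apply: cvge0_le pf => k; first exact: sobolev_bd_sqnorm_ge0.
  under eq_fun do rewrite -rmorphB.
  apply: lee_sum => j _; rewrite !(sobolev_sqnorm_lt1E _ half_itv).
  by rewrite boundary_piece_conj /sobolev_sqnorm_rec L2sqnorm_conj gagliardo_sqnorm_conj.
Qed.

Lemma sobolev_bd_dualB (psi chi : func -> R[i]) :
  sobolev_bd_dual Omega At psi -> sobolev_bd_dual Omega At chi ->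
  sobolev_bd_dual Omega At (fun h => psi h - chi h).
Proof.
move=> [psil [C psiC]] [chil [C' chiC]]; split.
  by move=> c f g Hf Hg; rewrite psil// chil//; ring.
(* The 2 comes from [sqnormcB_le]; absolute values are taken because distributivity over extended
   reals wants nonnegative factors and [C], [C'] carry no sign. *)
exists (2 * (`|C| + `|C'|)) => f Hf.
have N0 := sobolev_bd_sqnorm_ge0 (1 / 2) f.
have bound (x : R[i]) (B : R) : ((sqnormc x)%:E <= B%:E * sobolev_bd_sqnorm At (1 / 2) f)%E ->
    ((sqnormc x)%:E <= `|B|%:E * sobolev_bd_sqnorm At (1 / 2) f)%E.
  by move=> h; apply: le_trans h _; apply: lee_wpmul2r => //; rewrite lee_fin ler_norm.
rewrite EFinM (EFinD `|C|) -muleA ge0_muleDl ?lee_fin//.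
apply: (@le_trans _ _ (2%:E * ((sqnormc (psi f))%:E + (sqnormc (chi f))%:E))%E).
  by rewrite -EFinD -EFinM lee_fin sqnormcB_le.
by rewrite lee_pmul2l ?lte_fin//; apply: leeD; apply: bound; [exact: psiC|exact: chiC].
Qed.

Lemma neumann_traceB u v f g psi chi :
  neumann_trace Omega At u f psi -> neumann_trace Omega At v g chi ->
  neumann_trace Omega At (fun x => u x - v x) (fun x => f x - g x)
    (fun h => psi h - chi h).
Proof.
move=> [su [Lf uf] dpsi psiE] [sv [Lg vg] dchi chiE].
have Lu := sobolev_on_L2 oOmega su; have Lv := sobolev_on_L2 oOmega sv.
split.
- exact: sobolev_onB.
- split; first exact: (L2B mOmega).
  exact: weak_laplacianB.
- exact: sobolev_bd_dualB.
move=> Phi h sPhi tPhi GPhi Gw PhiG wG.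
have LPhi := sobolev_on_L2 oOmega sPhi.
have [Gu uG] := sobolev_on_weak_gradient oOmega su.
(* Solving for the gradient of [v] avoids the uniqueness of weak gradients. *)
have vG : weak_gradient Omega v (fun i x => Gu i x - Gw i x).
  have := weak_gradientB mOmega Lu (L2B mOmega Lu Lv) uG wG.
  by under [X in weak_gradient _ X]eq_fun do rewrite opprB addrC subrK.
rewrite (psiE _ _ sPhi tPhi _ _ PhiG uG) (chiE _ _ sPhi tPhi _ _ PhiG vG).
rewrite (L2dotBr mOmega Lf Lg LPhi) opprD addrACA; congr (_ + _).
rewrite -sumrB; apply: eq_bigr => i _.
have [LGP _] := PhiG i; have [LGu _] := uG i; have [LGw _] := wG i.
by rewrite (L2dotBr mOmega LGu LGw LGP) subKr.
Qed.

End boundary.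

(** * Resolvents, conjugation and Green's second identity *)

Section resolvents.
Context (R : realType) (n : nat).
Variables (Omega : set 'rV[R]_n) (At : atlas R n).
Hypothesis oOmega : open Omega.
Local Notation leb := (lebesgue_rV R n).
Local Notation func := ('rV[R]_n -> R[i]).
Local Notation surf := (surface_measure R n).
Local Notation bd := (frontier Omega).
Local Notation Hhalf := (sobolev_bd Omega At (1 / 2)).
Local Notation Dlap := (dirichlet_laplacian Omega At).
Implicit Types (u v f g w : func) (z : R[i]).

Let mOmega : measurable (Omega : set (caratheodory_type (lebesgue_outer R n))).
Proof. exact: open_lebesgue_measurable. Qed.

Lemma resolventP (A : func -> func -> Prop) z : ~ spectrum leb Omega A z ->
  is_resolvent leb Omega A z (resolvent leb Omega A z).
Proof. by move=> /contrapT; exact: xgetPex. Qed.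

Lemma dirichlet_laplacian_conj u w : Dlap u w ->
  Dlap (fun x => (u x)^*%C) (fun x => (w x)^*%C).
Proof.
move=> [su Lw uw tu]; have Lu := sobolev_on_L2 oOmega su; split.
- exact: sobolev_on_conj.
- exact: L2_conj.
- have := weak_laplacian_conj mOmega Lu (L2N Lw) uw.
  by under [X in weak_laplacian _ _ X]eq_fun do rewrite rmorphN.
- have := dirichlet_trace_conj tu.
  by under [X in dirichlet_trace _ _ _ X]eq_fun do rewrite conjc0.
Qed.

(* The Dirichlet Laplacian commutes with complex conjugation, so that its
   spectrum is symmetric without appeal to self-adjointness. *)
Lemma is_resolvent_conj z S : is_resolvent leb Omega Dlap z S ->
  is_resolvent leb Omega Dlap z^*%C
    (fun f x => (S (fun y => (f y)^*%C) x)^*%C).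
Proof.
move=> [[SL Slin [C SC]] SA SI]; split.
- split.
  + by move=> f Lf; apply: L2_conj; apply: SL; exact: L2_conj.
  + move=> c f g Lf Lg.
    have := Slin c^*%C _ _ (L2_conj Lf) (L2_conj Lg).
    rewrite (_ : (fun x => c^*%C * (f x)^*%C + (g x)^*%C) =
      (fun x => ((c * f x + g x)^*)%C)); last first.
      by apply/funext => x; rewrite rmorphD rmorphM.
    by apply: filterS => x + Dx => /(_ Dx) ->; rewrite rmorphD rmorphM/= conjcK.
  + exists C => f Lf; rewrite L2sqnorm_conj.
    by have := SC _ (L2_conj Lf); rewrite L2sqnorm_conj.
- move=> f Lf; have := dirichlet_laplacian_conj (SA _ (L2_conj Lf)).
  by under [X in Dlap _ X]eq_fun do rewrite rmorphD rmorphM/= conjcK.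
- move=> u w Auw; have := SI _ _ (dirichlet_laplacian_conj Auw).
  rewrite (_ : (fun x => (w x)^*%C - z * (u x)^*%C) =
    (fun x => ((w x - z^*%C * u x)^*)%C)); last first.
    by apply/funext => x; rewrite rmorphB rmorphM/= conjcK.
  by apply: filterS => x + Dx => /(_ Dx) ->; rewrite conjcK.
Qed.

(* Green's second identity between [u] and the Dirichlet resolvent of a test
   function at [conj z], whose Dirichlet trace vanishes. *)
Lemma adjoint_neumann_resolvent z Nbar u g psi :
  ~ spectrum leb Omega Dlap z ->
  is_neumann_resolvent Omega At z^*%C Nbar ->
  dirichlet_trace Omega At u g ->
  neumann_trace Omega At u (fun x => - (z * u x)) psi ->
  ae_eq leb Omega (adjoint_op leb Omega surf bd Nbar g) (fun x => - u x).
Proof.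
move=> zD [_ NbarE] ug uz; have [su _ [dpsil _] psiE] := uz.
have Lu := sobolev_on_L2 oOmega su; have LNu := L2N Lu.
have adj phi : L2 leb Omega phi ->
    L2dot leb Omega (fun x => - u x) phi = L2dot surf bd g (Nbar phi).
  move=> Lphi.
  have zD' : ~ spectrum leb Omega Dlap z^*%C.
    by apply; eexists; exact: is_resolvent_conj (resolventP zD).
  have [[SL _ _] /(_ _ Lphi) [sw _ _ w0] _] := resolventP zD'.
  have [chi [_ [Lw' _] _ chiE] chi_dot] := NbarE _ Lphi.
  set w := resolvent leb Omega Dlap z^*%C phi in sw w0 chiE chi_dot Lw'.
  have Lw : L2 leb Omega w by exact: SL.
  have [Gu uG] := sobolev_on_weak_gradient oOmega su.
  have [Gw wG] := sobolev_on_weak_gradient oOmega sw.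
  have Hg : Hhalf g by case: ug.
  have H0 : Hhalf (fun=> 0) by case: w0.
  (* Antilinearity at [1 * 0 + 0] reads [psi 0 = psi 0 + psi 0]; the zero function is in H^(1/2),
     being the trace of [w]. *)
  have psi0 : psi (fun=> 0) = 0.
    have := dpsil 1 _ _ H0 H0; rewrite conjc1.
    rewrite (_ : (fun x => _) = fun=> 0); last by apply/funext => x; rewrite mulr0 addr0.
    by rewrite mul1r => /eqP; rewrite -[X in X == _]addr0 => /eqP/addrI.
  (* The Neumann identity of [u] tested with [w], of trace 0: the gradient term equals [z] times the
     inner product of [w] and [u]. *)
  have := psiE _ _ sw w0 _ _ wG uG; rewrite psi0 => /esym/eqP.
  rewrite addr_eq0 => /eqP GwGu.
  have GuGw : \sum_(i < n) L2dot leb Omega (Gu i) (Gw i) =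
      z^*%C * L2dot leb Omega u w.
    rewrite (eq_bigr (fun i => (L2dot leb Omega (Gw i) (Gu i))^*%C)); last first.
      by move=> i _; apply: (L2dotC mOmega); [case: (uG i)|case: (wG i)].
    rewrite -rmorph_sum/= GwGu.
    rewrite (_ : (fun x => - (z * u x)) = fun x => (- z) * u x); last first.
      by apply/funext => x; rewrite mulNr.
    by rewrite (L2dotZr _ mOmega Lw Lu) mulNr opprK (L2dotC mOmega Lu Lw) rmorphM.
  (* The Neumann identity of [w] tested with [u], of trace [g]: the gradient term cancels the term
     with [conj z], leaving minus the inner product of [u] and [phi]. *)
  rewrite -[RHS](chi_dot _ Hg) (chiE _ _ su ug _ _ uG wG) GuGw.
  rewrite (_ : (fun x => - (phi x + z^*%C * w x)) =
    fun x => (- 1) * phi x - z^*%C * w x); last first.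
    by apply/funext => x; ring.
  rewrite (L2dotBr mOmega (L2Z _ mOmega Lphi) (L2Z _ mOmega Lw) Lu).
  rewrite (L2dotZr _ mOmega Lu Lw) (L2dotZr _ mOmega Lu Lphi).
  rewrite addrC subrK mulN1r.
  rewrite (_ : (fun x => - u x) = fun x => 0 - u x); last first.
    by apply/funext => x; rewrite sub0r.
  rewrite (L2dotBl mOmega (L2_0 _ _) Lu Lphi) (L2dotC mOmega (L2_0 _ _) Lphi).
  rewrite (_ : (fun=> 0) = fun x => 0 * phi x :> R[i]); last first.
    by apply/funext => x; rewrite mul0r.
  by rewrite (L2dotZr _ mOmega Lphi Lphi) mul0r conjc0 sub0r.
rewrite /adjoint_op.
(* [adjoint_op] chooses some representing element: [- u] shows that one exists, and any two agree
   almost everywhere. *)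
set P := [set v | _]; have [Lv vE] : P (xget (fun=> 0) P).
  by apply: xgetPex; exists (fun x => - u x).
apply: (L2dot_inj mOmega Lv LNu) => phi Lphi.
by rewrite vE// adj.
Qed.

End resolvents.

(** * Assembly of the Krein formula *)

Theorem theorem4p16 (R : realType) (n : nat) (n_ge2 : (2 <= n)%N)
  (Omega : set 'rV[R]_n)
  (Omega_open : open Omega) (Omega_bounded : bounded_set Omega)
  (Omega_neq0 : Omega !=set0) (Omega_lipschitz : lipschitz_domain Omega)
  (At : atlas R n) (At_Omega : boundary_atlas Omega At)
  (a : ('rV[R]_n -> R[i]) -> ('rV[R]_n -> R[i]) -> R[i]) (c : R)
  (a_sesquilinear : form_sesquilinear Omega At a)
  (a_symmetric : form_symmetric Omega At a)
  (a_bounded_below : form_bounded_below Omega At a c)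
  (a_closed : form_closed Omega At a c)
  (Theta : ('rV[R]_n -> R[i]) -> ('rV[R]_n -> R[i]) -> R[i])
  (Theta_bounded : bounded_half Omega At Theta)
  (Theta_a : associated_operator Omega At a Theta)
  (Theta_compact : compact_H1_L2 Omega At Theta)
  (z : R[i])
  (z_robin : ~ spectrum (lebesgue_rV R n) Omega
                 (robin_laplacian Omega At Theta) z)
  (z_dirichlet : ~ spectrum (lebesgue_rV R n) Omega
                 (dirichlet_laplacian Omega At) z)
  (N Nbar M : ('rV[R]_n -> R[i]) -> ('rV[R]_n -> R[i]))
  (N_def : is_neumann_resolvent Omega At z N)
  (Nbar_def : is_neumann_resolvent Omega At (z^*)%C Nbar)
  (M_def : is_robin_to_dirichlet Omega At Theta z M) :
  forall f : 'rV[R]_n -> R[i], L2 (lebesgue_rV R n) Omega f ->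
    ae_eq (lebesgue_rV R n) Omega
      (resolvent (lebesgue_rV R n) Omega (robin_laplacian Omega At Theta) z f)
      (fun x =>
         resolvent (lebesgue_rV R n) Omega (dirichlet_laplacian Omega At) z f x
         + adjoint_op (lebesgue_rV R n) Omega
             (surface_measure R n) (frontier Omega) Nbar (M (N f)) x).
Proof.
move=> f Lf.
have mOmega := open_lebesgue_measurable Omega_open.
have [_ _ robinI] := resolventP z_robin.
have [[DL _ _] /(_ _ Lf) [_ _ _ uD0] _] := resolventP z_dirichlet.
have [[NL _ _] /(_ _ Lf) [psiD uD_psi psiDE]] := N_def.
set uD := resolvent (lebesgue_rV R n) Omega (dirichlet_laplacian Omega At) z f
  in uD0 uD_psi *.
have [_ [u [[su ug [psi u_psi psiE]] _]]] := M_def _ (NL _ Lf).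
have LuD : L2 (lebesgue_rV R n) Omega uD by exact: DL.
have Lu := sobolev_on_L2 Omega_open su.
set g := M (N f) in ug psiE *.
have [Hg H0] : sobolev_bd Omega At (1 / 2) g /\ sobolev_bd Omega At (1 / 2) (fun=> 0).
  by case: ug uD0 => [? _] [? _].
pose y := fun x => uD x - u x.
have Ay : robin_laplacian Omega At Theta y (fun x => f x + z * y x).
  have Ly : L2 (lebesgue_rV R n) Omega y by exact: (L2B mOmega).
  split; first exact: (L2D mOmega Lf (L2Z _ mOmega Ly)).
  (* The trace of [y] is kept as [0 - g], the shape produced by [dirichlet_traceB] from the zero
     trace of [uD]. *)
  exists (fun x => 0 - g x), (fun h => psiD h - psi h); split.
  - apply: (dirichlet_traceB At_Omega _ uD0 ug).
    rewrite (_ : (fun x => 0 - g x) = fun x => - g x).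
      by apply: L2N; case: Hg.
    by apply/funext => x; rewrite sub0r.
  - have := neumann_traceB Omega_open uD_psi u_psi.
    rewrite (_ : (fun x => - (f x + z * uD x) - - (z * u x)) =
      fun x => - (f x + z * y x)); first by [].
    by apply/funext => x; rewrite /y; ring.
  - move=> h Hh; rewrite psiDE// -(psiE _ Hh).
    case: Theta_bounded => _ Theta_lin _.
    (* Linearity is a single law for [c * f + g]: [1 * 0 + 0] gives the value at 0, and then
       [c = -1] gives [Theta (0 - g) h = - Theta g h], which cancels
       [psiD h - psi h = Theta g h]. *)
    have Theta0 : Theta (fun=> 0) h = 0.
      have := Theta_lin 1 _ _ _ H0 H0 Hh.
      rewrite (_ : (fun x => _) = fun=> 0); last by apply/funext => x; rewrite mulr0 addr0.
      by rewrite mul1r => /eqP; rewrite -[X in X == _]addr0 => /eqP/addrI.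
    have := Theta_lin (- 1) _ _ _ Hg H0 Hh.
    rewrite (_ : (fun x => _) = fun x => 0 - g x); last first.
      by apply/funext => x; rewrite mulN1r addrC.
    by move=> ->; rewrite Theta0; ring.
have := robinI _ _ Ay.
(* The argument of the Robin resolvent is [(f + z * y) - z * y]. *)
rewrite (_ : (fun x => _) = f); last by apply/funext => x; rewrite addrK.
have := adjoint_neumann_resolvent Omega_open z_dirichlet Nbar_def ug u_psi.
by apply: filterS2 => x + + Dx => /(_ Dx) -> /(_ Dx) ->.
Qed.
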